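(* Let $R$ and $S$ be rings, $M$ an $R$-$S$-bimodule, $\Lambda=\begin{pmatrix}R&M\\ 0&S\end{pmatrix}$ the formal triangular matrix ring, $n\geqslant 1$ an integer, $\mathcal{X},\mathcal{M}$ classes of left $R$-modules and $\mathcal{Y},\mathcal{N}$ classes of left $S$-modules. (1) Let $(\mathcal{X},\mathcal{M})$ be a left $n$-cotorsion pair in $R$-$\mathrm{Mod}$ and $(\mathcal{Y},\mathcal{N})$ a left $n$-cotorsion pair in $S$-$\mathrm{Mod}$. Assume that $\mathrm{Ext}_R^j(M,\mathcal{M})=0$ for each $1\leqslant j\leqslant n$, $\begin{pmatrix}\mathcal{X}\\ \mathcal{Y}\end{pmatrix}$ is a resolving class, and $(\mathfrak{D}_{\mathcal{N}}^{\mathcal{M}})_{n-1}^{\wedge}$ is closed under extensions. Then $\left(\begin{pmatrix}\mathcal{X}\\ \mathcal{Y}\end{pmatrix},\mathfrak{D}_{\mathcal{N}}^{\mathcal{M}}\right)$ is a hereditary left $n$-cotorsion pair in $\Lambda$-$\mathrm{Mod}$. (2) Let $(\mathcal{X},\mathcal{M})$ be a right $n$-cotorsion pair in $R$-$\mathrm{Mod}$ and $(\mathcal{Y},\mathcal{N})$ a right $n$-cotorsion pair in $S$-$\mathrm{Mod}$. Assume that $\mathrm{Tor}_j^S(M,\mathcal{Y})=0$ for each $1\leqslant j\leqslant n$, $\begin{pmatrix}\mathcal{M}\\ \mathcal{N}\end{pmatrix}$ is a coresolving class, and $(\mathfrak{B}_{\mathcal{Y}}^{\mathcal{X}})_{n-1}^{\vee}$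 is closed under extensions. Then $\left(\mathfrak{B}_{\mathcal{Y}}^{\mathcal{X}},\begin{pmatrix}\mathcal{M}\\ \mathcal{N}\end{pmatrix}\right)$ is a hereditary right $n$-cotorsion pair in $\Lambda$-$\mathrm{Mod}$.
   Context: Rings are associative with identity, modules are unitary, and $S$-$\mathrm{Mod}$ is the category of left $S$-modules. Classes of modules contain $0$ and are closed under isomorphisms. $\mathrm{Ext}_R^j(M,\mathcal{M})=0$ means vanishing for every module in the class $\mathcal{M}$, and similarly for $\mathrm{Tor}$. A left $\Lambda$-module is identified with a triple $\begin{pmatrix}X\\ Y\end{pmatrix}_{\varphi}$, where $X\in R$-$\mathrm{Mod}$, $Y\in S$-$\mathrm{Mod}$ and $\varphi:M\otimes_S Y\to X$ is $R$-linear; morphisms to $\begin{pmatrix}X_1\\ Y_1\end{pmatrix}_{\varphi_1}$ are pairs $(f:X\to X_1,\,g:Y\to Y_1)$ with $\varphi_1(M\otimes_S g)=f\varphi$. The map $\varphi^M:Y\to\mathrm{Hom}_R(M,X)$ is $\varphi^M(y)(m)=\varphi(m\otimes y)$. $\begin{pmatrix}\mathcal{P}\\ \mathcal{Q}\end{pmatrix}$ is the class of left $\Lambda$-modules with first component in $\mathcal{P}$ and second component in $\mathcal{Q}$. $\mathfrak{B}_{\mathcal{Y}}^{\mathcal{X}}$ is the class of $\begin{pmatrix}X\\ Y\end{pmatrix}_{\varphi}$ with $Y\in\mathcal{Y}$, $\mathrm{Ker}\,\varphi=0$ and $\mathrm{Coker}\,\varphi\in\mathcal{X}$. $\mathfrak{D}_{\mathcal{N}}^{\mathcal{M}}$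 is the class of $\begin{pmatrix}Z\\ N\end{pmatrix}_{\varphi}$ with $Z\in\mathcal{M}$, $\mathrm{Ker}\,\varphi^M\in\mathcal{N}$ and $\mathrm{Coker}\,\varphi^M=0$. A class is resolving (resp. coresolving) if it is closed under extensions and kernels of epimorphisms (resp. extensions and cokernels of monomorphisms). For a class $\mathcal{C}$ of objects of an abelian category and $m\geqslant 0$: $\mathcal{C}_m^{\wedge}$ is the class of objects $A$ admitting an exact sequence $0\to C_k\to\cdots\to C_0\to A\to 0$ with all $C_i\in\mathcal{C}$ and some $k\leqslant m$; $\mathcal{C}_m^{\vee}$ is the class of objects $A$ admitting an exact sequence $0\to A\to C^0\to\cdots\to C^k\to 0$ with all $C^i\in\mathcal{C}$ and some $k\leqslant m$. A pair $(\mathcal{C},\mathcal{D})$ of classes of objects in an abelian category is a left $n$-cotorsion pair if (i) $\mathcal{C}$ is closed under direct summands, (ii) $\mathrm{Ext}^i(C,D)=0$ for all $1\leqslant i\leqslant n$, $C\in\mathcal{C}$, $D\in\mathcal{D}$, and (iii) every object $A$ admits a short exact sequence $0\to K\to C\to A\to 0$ with $C\in\mathcal{C}$, $K\in\mathcal{D}_{n-1}^{\wedge}$. It is a right $n$-cotorsion pair if (i') $\mathcal{D}$ is closed under direct summands, (ii) holds, and (iii') every object $A$ admits a short exact sequence $0\to A\to D\to K\to 0$ with $D\in\mathcal{D}$, $K\in\mathcal{C}_{n-1}^{\vee}$. A left or right $n$-cotorsion pair $(\mathcal{C},\mathcal{D})$ is hereditary if $\mathrm{Ext}^{n+1}(C,D)=0$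 for all $C\in\mathcal{C}$, $D\in\mathcal{D}$. *)

(* Defs.v *)
From HB Require Import structures.
From mathcomp Require Import all_boot all_order all_algebra.
From mathcomp Require Import boolp freeg.

Set Implicit Arguments.
Unset Strict Implicit.
Unset Printing Implicit Defensive.

Import GRing.Theory.
Local Open Scope ring_scope.
Local Open Scope quotient_scope.

(* Left R-modules are [lmodType R] with [R : pzRingType]: associative rings
   with identity, the zero ring included.  An R-S-bimodule is a left R-module
   with a compatible unitary right action [m ·r s] of S. *)
HB.mixin Record Lmodule_isBimodule (R S : pzRingType) M of GRing.Lmodule R M := {
  rscale : M -> S -> M;
  rscaleDl : forall m m' s, rscale (m + m') s = rscale m s + rscale m' s;
  rscaleDr : forall m s s', rscale m (s + s') = rscale m s + rscale m s';
  rscaleA : forall m s s', rscale (rscale m s) s' = rscale m (s * s');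
  rscale1 : forall m, rscale m 1 = m;
  rscaleAl : forall (r : R) m s, rscale (r *: m) s = r *: rscale m s
}.

#[short(type="bimodType")]
HB.structure Definition Bimodule (R S : pzRingType) :=
  {M of Lmodule_isBimodule R S M & GRing.Lmodule R M}.

Notation "m '·r' s" := (rscale m s) (at level 40, left associativity) : ring_scope.

Section Quotient.
Context {R : pzRingType} {V : lmodType R} (W : submodClosed V).

(* W again, as a predicate also known to be closed under opposites. *)
Definition sub_pred : {pred V} := fun v => v \in W.
Fact sub_pred_closed : zmod_closed sub_pred.
Proof.
split=> [|x y]; rewrite -!topredE /= /sub_pred ?rpred0 // => Wx Wy.
by rewrite rpredD // -scaleN1r rpredZ.
Qed.
HB.instance Definition _ := GRing.isZmodClosed.Build V sub_pred sub_pred_closed.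

Local Notation Q := {ideal_quot sub_pred}.

Definition quotmod : Type := Q.
HB.instance Definition _ := GRing.Zmodule.on quotmod.

Definition quotmod_pi (v : V) : quotmod := \pi_Q v.
Definition quotmod_repr (x : quotmod) : V := repr (x : Q).

Lemma quotmod_reprK : cancel quotmod_repr quotmod_pi.
Proof. by move=> x; exact: (reprK (x : Q)). Qed.
Lemma quotmod_piP v w : quotmod_pi v = quotmod_pi w <-> v - w \in W.
Proof.
by rewrite -[_ \in W]/(v - w \in sub_pred) Quotient.idealrBE; split=> /eqP.
Qed.
Lemma quotmod_piD v w : quotmod_pi (v + w) = quotmod_pi v + quotmod_pi w.
Proof. exact: (raddfD (\pi_Q)). Qed.

Definition quotmod_scale (a : R) (x : quotmod) : quotmod :=
  quotmod_pi (a *: quotmod_repr x).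

Lemma quotmod_scale_pi a v :
  quotmod_scale a (quotmod_pi v) = quotmod_pi (a *: v).
Proof.
apply/quotmod_piP; rewrite -scalerBr rpredZ //.
by apply/quotmod_piP; rewrite quotmod_reprK.
Qed.

Fact quotmod_scaleA a b x :
  quotmod_scale a (quotmod_scale b x) = quotmod_scale (a * b) x.
Proof. by rewrite -[x]quotmod_reprK !quotmod_scale_pi scalerA. Qed.
Fact quotmod_scale1 : left_id 1 quotmod_scale.
Proof. by move=> x; rewrite -[x]quotmod_reprK quotmod_scale_pi scale1r. Qed.
Fact quotmod_scaleDr : right_distributive quotmod_scale +%R.
Proof.
move=> a x y; rewrite -[x]quotmod_reprK -[y]quotmod_reprK -quotmod_piD.
by rewrite !quotmod_scale_pi scalerDr quotmod_piD.
Qed.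
Fact quotmod_scaleDl x : {morph quotmod_scale^~ x : a b / a + b}.
Proof.
move=> a b; rewrite -[x]quotmod_reprK !quotmod_scale_pi.
by rewrite scalerDl quotmod_piD.
Qed.
HB.instance Definition _ := GRing.Zmodule_isLmodule.Build R quotmod
  quotmod_scaleA quotmod_scale1 quotmod_scaleDr quotmod_scaleDl.

Fact quotmod_pi_linear : linear quotmod_pi.
Proof.
by move=> a v w; rewrite quotmod_piD -quotmod_scale_pi.
Qed.
HB.instance Definition _ := GRing.isLinear.Build R V quotmod *:%R quotmod_pi
  quotmod_pi_linear.

End Quotient.

Section KernelCokernel.
Context {R : pzRingType} {A B : lmodType R} (f : {linear A -> B}).

Definition ker_pred : {pred A} := fun x => f x == 0.
Fact ker_pred_closed : submod_closed ker_pred.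
Proof.
split=> [|a x y]; rewrite !unfold_in ?linear0 // => /eqP fx /eqP fy.
by rewrite linearP fx fy scaler0 addr0.
Qed.
HB.instance Definition _ := GRing.isSubmodClosed.Build R A ker_pred
  (GRing.submod_closed_semi ker_pred_closed).

Record kernel := Kernel {kernel_val :> A; _ : kernel_val \in ker_pred}.
HB.instance Definition _ := [isSub for kernel_val].
HB.instance Definition _ := [Choice of kernel by <:].
HB.instance Definition _ := [SubChoice_isSubLmodule of kernel by <:].

Definition im_pred : {pred B} := fun y => `[< exists x, f x = y >].
Fact im_pred_closed : submod_closed im_pred.
Proof.
split=> [|a x y]; first by apply/asboolP; exists 0; rewrite linear0.
move=> /asboolP[x' <-] /asboolP[y' <-]; apply/asboolP.
by exists (a *: x' + y'); rewrite linearP.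
Qed.
HB.instance Definition _ := GRing.isSubmodClosed.Build R B im_pred
  (GRing.submod_closed_semi im_pred_closed).

Definition cokernel : Type := quotmod im_pred.
HB.instance Definition _ := GRing.Lmodule.on cokernel.

End KernelCokernel.

Section GeneratedSubgroup.
Context {V : zmodType} (G : V -> Prop).

Definition gen_subgroup : {pred V} :=
  fun v => `[< forall H : zmodClosed V, (forall g, G g -> g \in H) -> v \in H >].
Fact gen_subgroup_closed : zmod_closed gen_subgroup.
Proof.
split=> [|x y /asboolP Gx /asboolP Gy]; apply/asboolP => H GH; first exact: rpred0.
by rewrite rpredB ?Gx ?Gy.
Qed.
HB.instance Definition _ := GRing.isZmodClosed.Build V gen_subgroup
  gen_subgroup_closed.
End GeneratedSubgroup.

Section Tensor.
Context {R S : pzRingType} (M : bimodType R S) (Y : lmodType S).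

Local Notation gen m y := (<< (m, y) >> : {freeg (M * Y)%type / int}).

Inductive tensor_relator : {freeg (M * Y)%type / int} -> Prop :=
| TensorDl m m' y : tensor_relator (gen (m + m') y - (gen m y + gen m' y))
| TensorDr m y y' : tensor_relator (gen m (y + y') - (gen m y + gen m y'))
| TensorA m s y : tensor_relator (gen (m ·r s) y - gen m (s *: y)).

Local Notation Q := {ideal_quot (gen_subgroup tensor_relator)}.

Definition tensor : Type := Q.
HB.instance Definition _ := GRing.Zmodule.on tensor.

Definition tensor_pi (g : {freeg (M * Y)%type / int}) : tensor := \pi_Q g.
Definition tensor_repr (t : tensor) : {freeg (M * Y)%type / int} := repr (t : Q).

Lemma tensor_reprK : cancel tensor_repr tensor_pi.
Proof. by move=> t; exact: (reprK (t : Q)). Qed.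
Lemma tensor_piP g h :
  tensor_pi g = tensor_pi h <-> g - h \in gen_subgroup tensor_relator.
Proof. by rewrite Quotient.idealrBE; split=> /eqP. Qed.
Fact tensor_piB : zmod_morphism tensor_pi.
Proof. exact: (raddfB (\pi_Q)). Qed.
HB.instance Definition _ := GRing.isZmodMorphism.Build _ tensor tensor_pi tensor_piB.

Definition tens (m : M) (y : Y) : tensor := tensor_pi (gen m y).

Fact tensor_pi_relator g h : tensor_relator (g - h) -> tensor_pi g = tensor_pi h.
Proof. by move=> rel; apply/tensor_piP/asboolP => H; apply. Qed.

Lemma tensDl m m' y : tens (m + m') y = tens m y + tens m' y.
Proof. exact: etrans (tensor_pi_relator (TensorDl _ _ _)) (raddfD tensor_pi _ _). Qed.
Lemma tensDr m y y' : tens m (y + y') = tens m y + tens m y'.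
Proof. exact: etrans (tensor_pi_relator (TensorDr _ _ _)) (raddfD tensor_pi _ _). Qed.
Lemma tensA m s y : tens (m ·r s) y = tens m (s *: y).
Proof. exact: tensor_pi_relator (TensorA _ _ _). Qed.

Definition balanced (V : zmodType) (b : M -> Y -> V) : Prop :=
  [/\ forall m m' y, b (m + m') y = b m y + b m' y,
      forall m y y', b m (y + y') = b m y + b m y'
    & forall m s y, b (m ·r s) y = b m (s *: y)].

Section Lift.
Context (V : zmodType) (b : M -> Y -> V).

Definition tensor_pre : {freeg (M * Y)%type / int} -> V :=
  fglift (fun p => b p.1 p.2 : zmodule V).

Definition tensor_lift (t : tensor) : V := tensor_pre (tensor_repr t).

Context (bP : balanced b).

Fact tensor_preB : zmod_morphism tensor_pre.
Proof. move=> g h; exact: (lift_is_additive (M := zmodule V)). Qed.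
Fact tensor_pre_gen m y : tensor_pre (gen m y) = b m y.
Proof. by rewrite /tensor_pre liftU scale1r. Qed.

Fact tensor_pre0 : tensor_pre 0 = 0. Proof. by have := tensor_preB 0 0; rewrite !subrr. Qed.
Fact tensor_preD g h : tensor_pre (g + h) = tensor_pre g + tensor_pre h.
Proof. by rewrite -[h in LHS]opprK tensor_preB -[- h]add0r tensor_preB tensor_pre0 sub0r opprK. Qed.

Definition tensor_pre_ker : {pred {freeg (M * Y)%type / int}} :=
  fun g => tensor_pre g == 0.
Fact tensor_pre_ker_closed : zmod_closed tensor_pre_ker.
Proof.
split=> [|g h]; rewrite !unfold_in ?tensor_pre0 //.
by move=> /eqP g0 /eqP h0; rewrite tensor_preB g0 h0 subrr.
Qed.
#[local] HB.instance Definition _ :=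
  GRing.isZmodClosed.Build _ tensor_pre_ker tensor_pre_ker_closed.

Fact tensor_lift_pi g : tensor_lift (tensor_pi g) = tensor_pre g.
Proof.
apply/eqP; rewrite -subr_eq0 -tensor_preB.
have /asboolP/(_ tensor_pre_ker) : tensor_repr (tensor_pi g) - g
    \in gen_subgroup tensor_relator by apply/tensor_piP; rewrite tensor_reprK.
case: bP => bDl bDr bA; apply=> _ [m m' y|m y y'|m s y]; rewrite unfold_in.
- by rewrite tensor_preB tensor_preD !tensor_pre_gen bDl subrr.
- by rewrite tensor_preB tensor_preD !tensor_pre_gen bDr subrr.
- by rewrite tensor_preB !tensor_pre_gen bA subrr.
Qed.

Lemma tensor_lift_tens m y : tensor_lift (tens m y) = b m y.
Proof. by rewrite tensor_lift_pi tensor_pre_gen. Qed.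

Lemma tensor_liftB : zmod_morphism tensor_lift.
Proof.
move=> t u; rewrite -[t]tensor_reprK -[u]tensor_reprK -raddfB.
by rewrite !tensor_lift_pi tensor_preB.
Qed.
End Lift.

Lemma tensor_hom_ext (V : zmodType) (f g : tensor -> V) :
  zmod_morphism f -> zmod_morphism g ->
  (forall m y, f (tens m y) = g (tens m y)) -> f =1 g.
Proof.
move=> fB gB fg t; rewrite -[t]tensor_reprK.
pose F := GRing.isZmodMorphism.Build tensor V f fB.
pose G := GRing.isZmodMorphism.Build tensor V g gB.
pose f' : {additive tensor -> V} := HB.pack f F.
pose g' : {additive tensor -> V} := HB.pack g G.
rewrite -[f]/(f' : tensor -> V) -[g]/(g' : tensor -> V).
rewrite -(freeg_sumE (tensor_repr t)) !raddf_sum; apply: eq_bigr => -[m y] _.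
set c := coeff _ _; have -> : << c *g (m, y) >> = gen m y *~ c.
  by rewrite freegU_mulz intz.
by rewrite raddfMz (raddfMz f') (raddfMz g') /= fg.
Qed.

Fact tens_scale_balanced (r : R) : balanced (fun m y => tens (r *: m) y).
Proof.
split=> [m m' y|m y y'|m s y]; first by rewrite scalerDr tensDl.
- exact: tensDr.
- by rewrite -rscaleAl tensA.
Qed.

(* r (m ⊗ y) = (r m) ⊗ y *)
Definition tensor_scale (r : R) : tensor -> tensor :=
  tensor_lift (fun m y => tens (r *: m) y).

Lemma tensor_scale_tens r m y : tensor_scale r (tens m y) = tens (r *: m) y.
Proof. exact: tensor_lift_tens (tens_scale_balanced r) _ _. Qed.

Fact tensor_scaleB r : zmod_morphism (tensor_scale r).
Proof. exact: tensor_liftB (tens_scale_balanced r). Qed.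
Fact tensor_scaleD r : {morph tensor_scale r : t u / t + u}.
Proof.
move=> t u; have s0 : tensor_scale r 0 = 0 by have := tensor_scaleB r 0 0; rewrite !subrr.
by rewrite -[u in LHS]opprK tensor_scaleB -[- u]add0r tensor_scaleB s0 sub0r opprK.
Qed.

Fact tensor_scaleA a b t : tensor_scale a (tensor_scale b t) = tensor_scale (a * b) t.
Proof.
apply: (tensor_hom_ext (f := tensor_scale a \o tensor_scale b)) t => [t u||m y].
- by rewrite /= !tensor_scaleB.
- exact: tensor_scaleB.
- by rewrite /= !tensor_scale_tens scalerA.
Qed.
Fact tensor_scale1 : left_id 1 tensor_scale.
Proof.
apply: (tensor_hom_ext (g := id)) => [||m y]; [exact: tensor_scaleB|by []|].
by rewrite tensor_scale_tens scale1r.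
Qed.
Fact tensor_scaleDr : right_distributive tensor_scale +%R.
Proof. exact: tensor_scaleD. Qed.
Fact tensor_scaleDl t : {morph tensor_scale^~ t : a b / a + b}.
Proof.
move=> a b.
apply: (tensor_hom_ext (g := tensor_scale a \+ tensor_scale b)) t => [|t u|m y].
- exact: tensor_scaleB.
- by rewrite /= !tensor_scaleB opprD addrACA.
- by rewrite /= !tensor_scale_tens scalerDl tensDl.
Qed.
HB.instance Definition _ := GRing.Zmodule_isLmodule.Build R tensor
  tensor_scaleA tensor_scale1 tensor_scaleDr tensor_scaleDl.

End Tensor.

(* M ⊗_S g *)
Definition tensor_map {R S : pzRingType} (M : bimodType R S) {Y Y' : lmodType S}
    (g : {linear Y -> Y'}) : tensor M Y -> tensor M Y' :=
  tensor_lift (fun m y => tens m (g y)).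
Arguments tensor_map {R S} M {Y Y'} g _.

Fact tensor_map_balanced {R S : pzRingType} (M : bimodType R S)
    (Y Y' : lmodType S) (g : {linear Y -> Y'}) :
  balanced (fun (m : M) y => tens m (g y)).
Proof.
by split=> [m m' y|m y y'|m s y]; rewrite ?linearD ?linearZ /= (tensDl, tensDr, tensA).
Qed.
Lemma tensor_map_tens {R S : pzRingType} (M : bimodType R S)
    (Y Y' : lmodType S) (g : {linear Y -> Y'}) m y :
  tensor_map M g (tens m y) = tens m (g y).
Proof. exact: tensor_lift_tens (tensor_map_balanced M g) _ _. Qed.

Section Hom.
Context {R S : pzRingType} (M : bimodType R S) (X : lmodType R).

Definition hom : Type := {linear M -> X}.
Definition fun_of_hom (f : hom) : {linear M -> X} := f.
Coercion fun_of_hom : hom >-> GRing.Linear.type.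
HB.instance Definition _ := gen_eqMixin hom.
HB.instance Definition _ := gen_choiceMixin hom.

Lemma homP (f g : hom) : f =1 g -> f = g.
Proof.
case: f g => [f [[f1] [f2]]] [g [[g1] [g2]]] /= /funext fg.
move: f1 f2 g1 g2; rewrite fg => f1 f2 g1 g2.
by rewrite (Prop_irrelevance f1 g1) (Prop_irrelevance f2 g2).
Qed.

Definition hom_zero : hom := \0%R : {linear M -> X}.
Definition hom_opp (f : hom) : hom := -%R \o f : {linear M -> X}.
Definition hom_add (f g : hom) : hom := f \+ g : {linear M -> X}.

Fact hom_addA : associative hom_add.
Proof. by move=> f g h; apply: homP => m /=; rewrite addrA. Qed.
Fact hom_addC : commutative hom_add.
Proof. by move=> f g; apply: homP => m /=; rewrite addrC. Qed.
Fact hom_add0 : left_id hom_zero hom_add.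
Proof. by move=> f; apply: homP => m /=; rewrite add0r. Qed.
Fact hom_addN : left_inverse hom_zero hom_opp hom_add.
Proof. by move=> f; apply: homP => m /=; rewrite addNr. Qed.
HB.instance Definition _ := GRing.isZmodule.Build hom hom_addA hom_addC hom_add0 hom_addN.

(* (s f)(m) = f (m s) *)
Definition hom_scale_fun (s : S) (f : hom) (m : M) : X := f (m ·r s).
Fact hom_scale_linear s f : linear (hom_scale_fun s f).
Proof. by move=> r m m'; rewrite /hom_scale_fun rscaleDl rscaleAl linearP. Qed.
HB.instance Definition _ s f := GRing.isLinear.Build R M X *:%R
  (hom_scale_fun s f) (hom_scale_linear s f).
Definition hom_scale (s : S) (f : hom) : hom :=
  hom_scale_fun s f : {linear M -> X}.

Fact hom_scaleA s t f : hom_scale s (hom_scale t f) = hom_scale (s * t) f.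
Proof. by apply: homP => m; rewrite /= /hom_scale_fun /= /hom_scale_fun rscaleA. Qed.
Fact hom_scale1 : left_id 1 hom_scale.
Proof. by move=> f; apply: homP => m; rewrite /= /hom_scale_fun rscale1. Qed.
Fact hom_scaleDr : right_distributive hom_scale +%R.
Proof. by move=> s f g; apply: homP. Qed.
Fact hom_scaleDl f : {morph hom_scale^~ f : s t / s + t}.
Proof.
by move=> s t; apply: homP => m; rewrite /= /hom_scale_fun rscaleDr linearD.
Qed.
HB.instance Definition _ := GRing.Zmodule_isLmodule.Build S hom
  hom_scaleA hom_scale1 hom_scaleDr hom_scaleDl.
End Hom.

Definition mod_class (T : pzRingType) : Type := lmodType T -> Prop.

Section Homological.
Context {T : pzRingType}.
Implicit Types (A B C : lmodType T) (cC cD : mod_class T).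

Definition is_zero_mod A : Prop := forall x : A, x = 0.

Definition iso_mod A B : Prop := exists f : {linear A -> B}, bijective f.

(* Assumed of every given class: it contains 0 and is isomorphism-closed. *)
Definition admissible cC : Prop :=
  (forall A, is_zero_mod A -> cC A) /\
  (forall A B, iso_mod A B -> cC A -> cC B).

Definition injective_map A B (f : {linear A -> B}) : Prop := injective f.
Definition surjective_map A B (f : {linear A -> B}) : Prop :=
  forall y, exists x, f x = y.
Definition exact_at A B C (f : {linear A -> B}) (g : {linear B -> C}) : Prop :=
  forall y, g y = 0 <-> exists x, f x = y.
Definition short_exact A B C (f : {linear A -> B}) (g : {linear B -> C}) : Prop :=
  [/\ injective_map f, exact_at f g & surjective_map g].

Record resolution A := Resolution {
  res_ob :> nat -> lmodType T;
  res_d : forall i, {linear res_ob i.+1 -> res_ob i};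
  res_aug : {linear res_ob 0%N -> A};
  res_aug_surj : surjective_map res_aug;
  res_exact0 : exact_at (res_d 0) res_aug;
  res_exact : forall i, exact_at (res_d i.+1) (res_d i)
}.

Record coresolution A := Coresolution {
  cores_ob :> nat -> lmodType T;
  cores_d : forall i, {linear cores_ob i -> cores_ob i.+1};
  cores_aug : {linear A -> cores_ob 0%N};
  cores_aug_inj : injective_map cores_aug;
  cores_exact0 : exact_at cores_aug (cores_d 0);
  cores_exact : forall i, exact_at (cores_d i) (cores_d i.+1)
}.

(* [wedge cC m] is the class C_m^∧ and [vee cC m] is C_m^∨; an exact sequence
   of length k is encoded as a (co)resolution that is zero beyond degree k. *)
Definition wedge cC (m : nat) : mod_class T := fun A =>
  exists (k : nat) (r : resolution A),
    [/\ (k <= m)%N, forall i, (i <= k)%N -> cC (r i)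
      & forall i, (k < i)%N -> is_zero_mod (r i)].
Definition vee cC (m : nat) : mod_class T := fun A =>
  exists (k : nat) (r : coresolution A),
    [/\ (k <= m)%N, forall i, (i <= k)%N -> cC (r i)
      & forall i, (k < i)%N -> is_zero_mod (r i)].

Definition projective (P : lmodType T) : Prop :=
  forall A B (g : {linear A -> B}) (f : {linear P -> B}), surjective_map g ->
    exists h : {linear P -> A}, forall x, g (h x) = f x.

Definition projective_resolution A (P : resolution A) : Prop :=
  forall i, projective (P i).

(* Ext^i(A, B) = 0, that is H^i(Hom(P, B)) = 0 for projective resolutions P of
   A; the choice of P does not matter. *)
Definition Ext_vanishes (i : nat) A B : Prop :=
  forall P : resolution A, projective_resolution P ->
  forall f : {linear P i -> B}, (forall x, f (res_d P i x) = 0) ->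
  match i return {linear P i -> B} -> Prop with
  | 0%N => fun f => forall x, f x = 0
  | j.+1 => fun f => exists g : {linear P j -> B}, forall x, f x = g (res_d P j x)
  end f.

Definition closed_summands cC : Prop :=
  forall A B C, iso_mod (A * B)%type C -> cC C -> cC A.
Definition closed_extensions cC : Prop :=
  forall A B C (f : {linear A -> B}) (g : {linear B -> C}),
    short_exact f g -> cC A -> cC C -> cC B.
Definition closed_ker_epi cC : Prop :=
  forall B C (g : {linear B -> C}),
    surjective_map g -> cC B -> cC C -> cC (kernel g).
Definition closed_coker_mono cC : Prop :=
  forall A B (f : {linear A -> B}),
    injective_map f -> cC A -> cC B -> cC (cokernel f).

Definition resolving cC : Prop := closed_extensions cC /\ closed_ker_epi cC.
Definition coresolving cC : Prop := closed_extensions cC /\ closed_coker_mono cC.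

Definition Ext_orthogonal (n : nat) cC cD : Prop :=
  forall i C D, (1 <= i <= n)%N -> cC C -> cD D -> Ext_vanishes i C D.

Definition left_cotorsion_pair (n : nat) cC cD : Prop :=
  [/\ closed_summands cC, Ext_orthogonal n cC cD
    & forall A, exists (K C : lmodType T) (f : {linear K -> C}) (g : {linear C -> A}),
        [/\ short_exact f g, cC C & wedge cD n.-1 K]].
Definition right_cotorsion_pair (n : nat) cC cD : Prop :=
  [/\ closed_summands cD, Ext_orthogonal n cC cD
    & forall A, exists (D K : lmodType T) (f : {linear A -> D}) (g : {linear D -> K}),
        [/\ short_exact f g, cD D & vee cC n.-1 K]].

Definition hereditary (n : nat) cC cD : Prop :=
  forall C D, cC C -> cD D -> Ext_vanishes n.+1 C D.

End Homological.

(* Tor_i^S(M, Y) = 0, that is H_i(M ⊗_S P) = 0 for projective resolutions P of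
   Y; the choice of P does not matter. *)
Definition Tor_vanishes {R S : pzRingType} (i : nat) (M : bimodType R S)
    (Y : lmodType S) : Prop :=
  forall P : resolution Y, projective_resolution P ->
  forall t : tensor M (P i),
  match i return tensor M (P i) -> Prop with
  | 0%N => fun=> True
  | j.+1 => fun t => tensor_map M (res_d P j) t = 0
  end t ->
  exists u : tensor M (P i.+1), tensor_map M (res_d P i) u = t.

(* The triple (r, m, s) stands for the matrix with rows (r, m) and (0, s). *)
Definition triring (R S : pzRingType) (M : bimodType R S) : Type := (R * M * S)%type.

Section TriangularRing.
Context {R S : pzRingType} (M : bimodType R S).

HB.instance Definition _ := GRing.Zmodule.copy (triring M) (R * M * S)%type.

Definition tri_one : triring M := (1, 0, 1).
Definition tri_mul (a b : triring M) : triring M :=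
  (a.1.1 * b.1.1, a.1.1 *: b.1.2 + a.1.2 ·r b.2, a.2 * b.2).

Fact rscale0l (s : S) : (0 : M) ·r s = 0.
Proof. by apply: (addrI ((0 : M) ·r s)); rewrite -rscaleDl !addr0. Qed.

Fact tri_mulA : associative tri_mul.
Proof.
move=> [[r m] s] [[r' m'] s'] [[r2 m2] s2]; congr (_, _, _) => /=; rewrite ?mulrA //.
by rewrite scalerDr scalerA rscaleDl rscaleAl rscaleA addrA.
Qed.
Fact tri_mul1 : left_id tri_one tri_mul.
Proof.
by case=> [[r m] s]; congr (_, _, _); rewrite /= ?mul1r // scale1r rscale0l addr0.
Qed.
Fact tri_mulr1 : right_id tri_one tri_mul.
Proof.
by case=> [[r m] s]; congr (_, _, _); rewrite /= ?mulr1 // scaler0 rscale1 add0r.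
Qed.
Fact tri_mulDl : left_distributive tri_mul +%R.
Proof.
move=> [[r m] s] [[r' m'] s'] [[r2 m2] s2]; congr (_, _, _); rewrite /= ?mulrDl //.
by rewrite scalerDl rscaleDl addrACA.
Qed.
Fact tri_mulDr : right_distributive tri_mul +%R.
Proof.
move=> [[r m] s] [[r' m'] s'] [[r2 m2] s2]; congr (_, _, _); rewrite /= ?mulrDr //.
by rewrite scalerDr rscaleDr addrACA.
Qed.
HB.instance Definition _ := GRing.Zmodule_isPzRing.Build (triring M)
  tri_mulA tri_mul1 tri_mulr1 tri_mulDl tri_mulDr.

Record triple := Triple {
  tri_fst : lmodType R;
  tri_snd : lmodType S;
  tri_phi : {linear tensor M tri_snd -> tri_fst}
}.

(* The Λ-module attached to a triple: column vectors (x, y)^T, with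
   (r, m, s) (x, y) = (r x + φ(m ⊗ y), s y). *)
Definition tri_mod (t : triple) : Type := (tri_fst t * tri_snd t)%type.
HB.instance Definition _ t :=
  GRing.Zmodule.copy (tri_mod t) (tri_fst t * tri_snd t)%type.

Definition tri_scale t (a : triring M) (v : tri_mod t) : tri_mod t :=
  (a.1.1 *: v.1 + tri_phi t (tens a.1.2 v.2), a.2 *: v.2).

Fact tri_scaleA t a b (v : tri_mod t) :
  tri_scale a (tri_scale b v) = tri_scale (a * b) v.
Proof.
case: a b v => [[r m] s] [[r' m'] s'] [x y]; congr (_, _); rewrite /= ?scalerA //.
rewrite scalerDr scalerA -linearZ /= [_ *: tens _ _]tensor_scale_tens.
by rewrite tensDl linearD tensA addrA.
Qed.
Fact tens0l (Y : lmodType S) (y : Y) : tens (0 : M) y = 0.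
Proof. by apply: (addrI (tens (0 : M) y)); rewrite -tensDl !addr0. Qed.
Fact tri_scale1 t : left_id (1 : triring M) (@tri_scale t).
Proof.
by case=> x y; congr (_, _); rewrite /= ?scale1r // tens0l linear0 addr0.
Qed.
Fact tri_scaleDr t : right_distributive (@tri_scale t) +%R.
Proof.
move=> [[r m] s] [x y] [x' y']; congr (_, _); rewrite /= scalerDr //.
by rewrite tensDr linearD addrACA.
Qed.
Fact tri_scaleDl t (v : tri_mod t) :
  {morph (@tri_scale t)^~ v : a b / a + b}.
Proof.
move: v => [x y] [[r m] s] [[r' m'] s']; congr (_, _); rewrite /= scalerDl //.
by rewrite tensDl linearD addrACA.
Qed.
HB.instance Definition _ t := GRing.Zmodule_isLmodule.Build (triring M)
  (tri_mod t) (@tri_scaleA t) (@tri_scale1 t) (@tri_scaleDr t) (@tri_scaleDl t).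

(* φ^M : Y -> Hom_R(M, X), φ^M(y)(m) = φ(m ⊗ y) *)
Section Adjoint.
Context (t : triple).
Definition tri_adj_fun (y : tri_snd t) (m : M) : tri_fst t :=
  tri_phi t (tens m y).
Fact tri_adj_fun_linear y : linear (tri_adj_fun y).
Proof.
move=> r m m'; rewrite /tri_adj_fun tensDl linearD -linearZ /=.
by rewrite [_ *: tens _ _]tensor_scale_tens.
Qed.
HB.instance Definition _ y := GRing.isLinear.Build R M (tri_fst t) *:%R
  (tri_adj_fun y) (tri_adj_fun_linear y).
Definition tri_adj (y : tri_snd t) : hom M (tri_fst t) :=
  tri_adj_fun y : {linear M -> tri_fst t}.
Fact tri_adj_linear : linear tri_adj.
Proof.
move=> s y y'; apply: homP => m.
by rewrite /= /tri_adj_fun /hom_scale_fun /= /tri_adj_fun tensDr linearD tensA.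
Qed.
HB.instance Definition _ := GRing.isLinear.Build S (tri_snd t)
  (hom M (tri_fst t)) *:%R tri_adj tri_adj_linear.
End Adjoint.

(* A class of triples, seen as a class of left Λ-modules through the
   identification of Λ-modules with triples. *)
Definition tri_class (Q : triple -> Prop) : mod_class (triring M) :=
  fun A => exists t : triple, Q t /\ iso_mod (tri_mod t) A.

Definition comp_class (cP : mod_class R) (cQ : mod_class S) :
    mod_class (triring M) :=
  tri_class (fun t => cP (tri_fst t) /\ cQ (tri_snd t)).

Definition frakB (cX : mod_class R) (cY : mod_class S) : mod_class (triring M) :=
  tri_class (fun t =>
    [/\ cY (tri_snd t), is_zero_mod (kernel (tri_phi t))
      & cX (cokernel (tri_phi t))]).

Definition frakD (cM : mod_class R) (cN : mod_class S) : mod_class (triring M) :=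
  tri_class (fun t =>
    [/\ cM (tri_fst t), cN (kernel (@tri_adj t))
      & is_zero_mod (cokernel (@tri_adj t))]).

End TriangularRing.

Arguments comp_class {R S} M cP cQ _.
Arguments frakB {R S} M cX cY _.
Arguments frakD {R S} M cM cN _.

(* Main.v *)
From HB Require Import structures.
From mathcomp Require Import all_boot all_order all_algebra.
From mathcomp Require Import boolp freeg.
Require Import Defs.

(** Everything reduces to Ext^1, so that no higher Ext over Lambda is ever
    computed.

    (1) Write a Lambda-module as a triple (X, Y, phi).  If D = (Z, N, psi) lies in
    frakD M cM cN, then 0 -> (0, Ker psi^M) -> D -> (Z, Hom(M, Z)) -> 0 is exact
    ([frakD_ses]).  Mapping into (0, N') and into (Z, Hom(M, Z)) amounts, by
    adjunction, to mapping the lower component into N' and the upper component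
    into Z; hence Ext^1(C, D) vanishes for C in the class (cX, cY)
    ([Ext1_comp_frakD]).  This class is closed under kernels of epimorphisms, and
    it contains all projectives P: the lower component of P is projective, and the
    identity of the upper component lifts through its cX-approximation because
    that lifting problem is one for P and the modules (X, Hom(M, X))
    ([comp_class_projective]).  All syzygies of C therefore stay in the class, so
    Ext^i(C, D) = 0 for every i >= 1 ([Ext_vanishes_of_resolving]).  To
    approximate (U, V), take 0 -> Z' -> X -> U -> 0, pull V back along the
    surjection Hom(M, X) -> Hom(M, U) to V', and take 0 -> N' -> Y -> V' -> 0; the
    kernel of (X, Y) -> (U, V) is an extension of (Z', Hom(M, Z')) by (0, N')
    ([comp_approximation]).  The vanishing of Ext^j(M, cM) for 1 <= j <= n keeps
    Hom(M, -) exact on a cM-resolution of Z'.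

    (2) If C = (X, Y, phi) lies in frakB M cX cY, then
    0 -> (M (x) Y, Y) -> C -> (Coker phi, 0) -> 0 is exact and the dual adjunctions
    give Ext^1(C, D) = 0 for D in (cM, cN) ([Ext1_frakB_comp]).  For higher Ext the
    shift is made in the second variable: a cocycle P_{i+2} -> D becomes a coboundary in the pushout of D along the image of
    P_{i+2} -> P_{i+1}, that pushout embeds in some D1 in (cM, cN) by the
    coapproximation sequence, and D1 / D is again in (cM, cN)
    ([Ext_vanishes_of_coresolving]).  To coapproximate (U, V), take
    0 -> V -> N -> Y' -> 0, push U out along the injection M (x) V -> M (x) N to U',
    and take 0 -> U' -> Z -> X' -> 0; the cokernel of (U, V) -> (Z, N) is an
    extension of (X', 0) by (M (x) Y', Y') ([comp_coapproximation]).  The vanishing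
    of Tor_j(M, cY) for 1 <= j <= n keeps M (x) - exact on a cY-coresolution of
    Y'; the shifts in the long exact sequence of Tor that this needs are proved
    for arbitrary short exact sequences by one simultaneous induction
    ([Tor_zero_shift]).

    Both vanishing hypotheses are stated on projective resolutions, whose existence
    comes from free modules, built as T (x)_Z Z[A]. *)

Set Implicit Arguments.
Unset Strict Implicit.
Unset Printing Implicit Defensive.

Import GRing.Theory.
Local Open Scope ring_scope.

(** * Linear maps and short exact sequences *)

Section Linear.
Context {T : pzRingType}.
Implicit Types A B C D E F K L P Q W : lmodType T.

Lemma linear_of_fun A B (f : A -> B) :
  linear f -> exists g : {linear A -> B}, forall x, g x = f x.
Proof.
move=> fl; pose F := GRing.isLinear.Build T A B *:%R f fl.
by exists (HB.pack f F : {linear A -> B}).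
Qed.

Lemma injective_map0 A B (f : {linear A -> B}) :
  (forall x, f x = 0 -> x = 0) -> injective_map f.
Proof.
by move=> f0 x y fxy; apply/eqP; rewrite -subr_eq0; apply/eqP/f0; rewrite linearB fxy subrr.
Qed.

(** Inverse images under an injection are unique, so a pointwise choice of them
    is linear.  Together with [descend_epi] this is how maps into kernels and out
    of quotients are built below. *)
Lemma lift_mono A B E (f : {linear A -> B}) (h : {linear E -> B}) :
  injective_map f -> (forall x, exists a, f a = h x) ->
  exists h' : {linear E -> A}, forall x, f (h' x) = h x.
Proof.
move=> finj /choice[k kP].
have [|h' h'E] := @linear_of_fun E A k.
  by move=> a x y; apply: finj; rewrite linearP !kP linearP.
by exists h' => x; rewrite h'E kP.
Qed.

Lemma descend_epi B C E (g : {linear B -> C}) (h : {linear B -> E}) :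
  surjective_map g -> (forall x, g x = 0 -> h x = 0) ->
  exists h' : {linear C -> E}, forall x, h' (g x) = h x.
Proof.
move=> /choice[k kP] h0.
have hE x y : g x = g y -> h x = h y.
  by move=> gxy; apply/eqP; rewrite -subr_eq0 -linearB h0 // linearB gxy subrr.
have [|h' h'E] := @linear_of_fun C E (h \o k).
  by move=> a x y /=; rewrite -linearP; apply: hE; rewrite linearP !kP.
by exists h' => x; rewrite h'E; apply: hE; rewrite kP.
Qed.

Lemma exact_comp0 A B C (f : {linear A -> B}) (g : {linear B -> C}) :
  exact_at f g -> forall x, g (f x) = 0.
Proof. by move=> ex x; apply/ex; exists x. Qed.

Lemma kernel_short_exact A B (g : {linear A -> B}) : surjective_map g ->
  exists i : {linear kernel g -> A}, short_exact i g.
Proof.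
move=> gs; have [|i iE] := @linear_of_fun (kernel g) A (val : kernel g -> A).
  by move=> a x y; rewrite linearP.
exists i; split=> //.
  by move=> x y; rewrite !iE => /val_inj.
move=> y; split=> [gy|[x <-]]; last by rewrite iE; case: x => x /= /eqP.
have yk : y \in ker_pred g by rewrite unfold_in gy.
by exists (Sub y yk : kernel g); rewrite iE SubK.
Qed.

Lemma cokernel_short_exact A B (f : {linear A -> B}) : injective_map f ->
  exists p : {linear B -> cokernel f}, short_exact f p.
Proof.
move=> finj; exists (quotmod_pi (im_pred f) : {linear B -> cokernel f}); split=> //.
  move=> y; rewrite -(linear0 (quotmod_pi (im_pred f))).
  split=> [/quotmod_piP|[x <-]].
    by rewrite subr0 => /asboolP.
  by apply/quotmod_piP; rewrite subr0; apply/asboolP; exists x.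
by move=> y; exists (quotmod_repr y); exact: quotmod_reprK.
Qed.

Lemma bij_iso A B (f : {linear A -> B}) :
  injective_map f -> surjective_map f -> iso_mod A B.
Proof.
move=> fi fs; exists f; have [g gP] := choice fs.
by exists g => // x; apply: fi; rewrite gP.
Qed.

Lemma iso_maps A B : iso_mod A B ->
  exists (f : {linear A -> B}) (g : {linear B -> A}),
    (forall x, g (f x) = x) /\ (forall y, f (g y) = y).
Proof.
case=> f [g fK gK]; have [|g' g'E] := @linear_of_fun B A g.
  by move=> a x y; rewrite -{1}[x]gK -{1}[y]gK -linearP fK.
by exists f, g'; split=> x; rewrite g'E.
Qed.

Lemma iso_sym A B : iso_mod A B -> iso_mod B A.
Proof. by case/iso_maps=> f [g [fK gK]]; exists g; exists f. Qed.

Lemma iso_refl A : iso_mod A A.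
Proof. by exists (idfun : {linear A -> A}); exists id. Qed.

Lemma iso_trans A B C : iso_mod A B -> iso_mod B C -> iso_mod A C.
Proof. by move=> [f fb] [g gb]; exists (g \o f : {linear A -> C}); exact: bij_comp. Qed.

Lemma short_exact_iso3 A B C C' (f : {linear A -> B}) (g : {linear B -> C}) :
  short_exact f g -> iso_mod C C' -> exists g' : {linear B -> C'}, short_exact f g'.
Proof.
move=> [fi ex gs] /iso_maps[u [v [uK vK]]]; exists (u \o g : {linear B -> C'}); split=> //.
  move=> y /=; rewrite -ex; split=> [/(congr1 v)|->]; last exact: linear0.
  by rewrite uK linear0.
by move=> y; have [x xE] := gs (v y); exists x; rewrite /= xE vK.
Qed.

Lemma short_exact_iso1 A A' B C (f : {linear A -> B}) (g : {linear B -> C}) :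
  short_exact f g -> iso_mod A' A -> exists f' : {linear A' -> B}, short_exact f' g.
Proof.
move=> [fi ex gs] /iso_maps[u [v [uK vK]]]; exists (f \o u : {linear A' -> B}); split=> //.
  by move=> x y /fi /(congr1 v); rewrite !uK.
move=> y; rewrite ex; split=> -[x <-]; first by exists (v x); rewrite /= vK.
by exists (u x).
Qed.

Lemma short_exact_iso2 A B B' C (f : {linear A -> B}) (g : {linear B -> C}) :
  short_exact f g -> iso_mod B B' ->
  exists (f' : {linear A -> B'}) (g' : {linear B' -> C}), short_exact f' g'.
Proof.
move=> [fi ex gs] /iso_maps[u [v [uK vK]]].
exists (u \o f : {linear _ -> _}), (g \o v : {linear _ -> _}); split.
- by move=> x y /(congr1 v); rewrite /= !uK => /fi.
- move=> y; rewrite /= ex; split=> -[x xE]; exists x; first by rewrite /= xE vK.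
  by rewrite -xE /= uK.
- by move=> z; have [x <-] := gs z; exists (u x); rewrite /= uK.
Qed.

Lemma short_exact_cokernel_iso A B C C' (f : {linear A -> B})
    (g : {linear B -> C}) (g' : {linear B -> C'}) :
  short_exact f g -> short_exact f g' -> iso_mod C C'.
Proof.
move=> [fi ex gs] [_ ex' gs'].
have [|h hP] := @descend_epi B C C' g g' gs.
  by move=> x /ex ?; apply/ex'.
apply: (bij_iso (f := h)) => [|y].
  apply: injective_map0 => y; have [x <-] := gs y.
  by rewrite hP => /ex' ?; apply/ex.
by have [x <-] := gs' y; exists (g x).
Qed.

(** The last two clauses are the universal property of the pullback W in
    element form: W consists exactly of the compatible pairs. *)
Lemma pullback_ses K B A F (k : {linear K -> B}) (g : {linear B -> A})
    (h : {linear F -> A}) : short_exact k g ->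
  exists (W : lmodType T) (i : {linear K -> W}) (p : {linear W -> F})
      (u : {linear W -> B}),
    [/\ short_exact i p, forall x, u (i x) = k x, forall w, g (u w) = h (p w),
        forall b f, g b = h f -> exists w, u w = b /\ p w = f
      & forall w, u w = 0 -> p w = 0 -> w = 0].
Proof.
move=> [ki ex gs].
have [|d dE] := @linear_of_fun (B * F)%type A (fun x => g x.1 - h x.2).
  by move=> a x y /=; rewrite [g _]linearP [h _]linearP opprD addrACA scalerBr.
have [|j jE] := @linear_of_fun (kernel d) (B * F)%type (val : kernel d -> _).
  by move=> a x y; rewrite linearP.
have [|u uE] := @linear_of_fun (kernel d) B (fun w => (j w).1).
  by move=> a x y; rewrite linearP.
have [|p pE] := @linear_of_fun (kernel d) F (fun w => (j w).2).
  by move=> a x y; rewrite linearP.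
have W0 w : u w = 0 -> p w = 0 -> w = 0.
  rewrite uE pE => u0 p0; apply: val_inj; rewrite -jE.
  by rewrite [LHS]surjective_pairing u0 p0.
have WE b f : g b = h f -> exists w, u w = b /\ p w = f.
  move=> gh; have k0 : (b, f) \in ker_pred d by rewrite unfold_in dE /= gh subrr.
  by exists (Sub (b, f) k0 : kernel d); rewrite uE pE jE.
have sq w : g (u w) = h (p w).
  apply/eqP; rewrite -subr_eq0 uE pE -(dE (j w)) jE.
  by case: w => w /=.
have [|i0 i0E] := @linear_of_fun K (B * F)%type (fun x => (k x, 0)).
  by move=> a x y; rewrite linearP; congr pair; rewrite /= scaler0 addr0.
have /(@lift_mono _ _ K j i0)[|i iE] : injective_map j.
  by move=> x y; rewrite !jE => /val_inj.
  move=> x; have [|w [w1 w2]] := WE (k x) 0.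
    by rewrite (exact_comp0 ex) linear0.
  by exists w; rewrite i0E [LHS]surjective_pairing -uE -pE w1 w2.
have ui x : u (i x) = k x by rewrite uE iE i0E.
have pi0 x : p (i x) = 0 by rewrite pE iE i0E.
exists (kernel d), i, p, u; split=> //; split.
- by move=> x y /(congr1 u); rewrite !ui => /ki.
- move=> w; split=> [pw|[x <-] //].
  have /ex[x xE] : g (u w) = 0 by rewrite sq pw linear0.
  exists x; apply/eqP; rewrite -subr_eq0; apply/eqP/W0; rewrite linearB ?ui ?xE ?subrr //.
  by rewrite pi0 pw subrr.
- by move=> f; have [b bE] := gs (h f); have [w [_ wE]] := WE b f bE; exists w.
Qed.

(** The usual cross of two short exact sequences with common end A: comparing
    two presentations of A goes through their pullback W, which maps onto the
    middle term of each with kernel that of the other. *)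
Lemma pullback_cross K E L F A (k : {linear K -> E}) (g : {linear E -> A})
    (l : {linear L -> F}) (h : {linear F -> A}) :
  short_exact k g -> short_exact l h ->
  exists (W : lmodType T) (i : {linear K -> W}) (p : {linear W -> F})
      (j : {linear L -> W}) (u : {linear W -> E}),
    [/\ short_exact i p, short_exact j u, forall x, u (i x) = k x
      & forall y, p (j y) = l y].
Proof.
move=> kg [li lex hs].
have [W [i [p [u [ip ui sq WE W0]]]]] := pullback_ses h kg.
have [W' [j [u' [p' [ju pj sq' WE' W0']]]]] := pullback_ses g (And3 li lex hs).
have [|d dE] := @linear_of_fun L (E * F)%type (fun x => (0, l x)).
  by move=> a x y; rewrite linearP; congr pair; rewrite /= scaler0 addr0.
have ex_j y : exists w, u w = 0 /\ p w = l y.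
  by apply: WE; rewrite linear0 (exact_comp0 lex).
have [|v vE] := @linear_of_fun W (E * F)%type (fun w => (u w, p w)).
  by move=> a x y; rewrite !linearP.
have [||j' j'E] := @lift_mono W _ L v d.
- apply: injective_map0 => w; rewrite vE => -[]; exact: W0.
- by move=> y; have [w [w1 w2]] := ex_j y; exists w; rewrite vE dE w1 w2.
have uj y : u (j' y) = 0 by have := congr1 fst (j'E y); rewrite vE dE.
have pj' y : p (j' y) = l y by have := congr1 snd (j'E y); rewrite vE dE.
exists W, i, p, j', u; split=> //; split.
- by move=> x y /(congr1 p); rewrite !pj' => /li.
- move=> w; split=> [uw|[y <-] //].
  have /lex[y yE] : h (p w) = 0 by rewrite -sq uw linear0.
  exists y; apply/eqP; rewrite -subr_eq0; apply/eqP/W0; rewrite linearB.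
    by rewrite uj uw subrr.
  by rewrite pj' yE subrr.
- by move=> e; have [f fE] := hs (g e); have [|w [wE _]] := WE e f; last exists w.
Qed.

(** The pushout of E along f is the quotient of D * E by the graph of (f, - i);
    its elements are all of the form j d + u e. *)
Lemma pushout_ses K E C D (i : {linear K -> E}) (p : {linear E -> C})
    (f : {linear K -> D}) : short_exact i p ->
  exists (W : lmodType T) (j : {linear D -> W}) (q : {linear W -> C})
      (u : {linear E -> W}),
    [/\ short_exact j q, forall x, u (i x) = j (f x), forall e, q (u e) = p e
      & forall w, exists d e, w = j d + u e].
Proof.
move=> [ii ex ps].
have [|a aE] := @linear_of_fun K (D * E)%type (fun x => (f x, - i x)).
  by move=> c x y; rewrite !linearP; congr pair; rewrite /= opprD scalerN.
have [|pi [_ piex pis]] := @cokernel_short_exact _ _ a.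
  by move=> x y; rewrite !aE => -[_ /oppr_inj/ii].
have [|j jE] := @linear_of_fun D (cokernel a) (fun d => pi (d, 0)).
  move=> c x y; rewrite -linearP; congr (pi (_, _)).
  by rewrite /= scaler0 addr0.
have [|u uE] := @linear_of_fun E (cokernel a) (fun d => pi (0, d)).
  move=> c x y; rewrite -linearP; congr (pi (_, _)).
  by rewrite /= scaler0 addr0.
have piE d e : pi (d, e) = j d + u e.
  by rewrite jE uE -linearD; congr (pi (_, _)); rewrite /= ?addr0 ?add0r.
have [|b bE] := @linear_of_fun (D * E)%type C (fun x => p x.2).
  by move=> c x y; rewrite linearP.
have [|q qE] := @descend_epi _ (cokernel a) C pi b pis.
  by move=> x /piex[y <-]; rewrite bE aE /= linearN (exact_comp0 ex) oppr0.
have qpi d e : q (pi (d, e)) = p e by rewrite qE bE.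
exists (cokernel a), j, q, u; split.
- split.
  + apply: injective_map0 => d; rewrite jE => /piex[x]; rewrite aE => -[<- /eqP].
    by rewrite oppr_eq0 -(linear0 i) => /eqP/ii ->; rewrite linear0.
  + move=> w; split=> [|[d <-]]; last by rewrite jE qpi linear0.
    have [[d e] <-] := pis w; rewrite qpi => /ex[x xE].
    exists (d + f x); apply/eqP; rewrite -subr_eq0 jE -linearB; apply/eqP/piex.
    exists x; rewrite aE xE; congr pair; rewrite /= ?sub0r //.
    by rewrite addrC addKr.
  + by move=> c; have [e <-] := ps c; exists (pi (0, e)); rewrite qpi.
- move=> x; apply/eqP; rewrite -subr_eq0 jE uE -linearB; apply/eqP/piex.
  exists (- x); rewrite aE !linearN opprK; congr pair; rewrite /= ?sub0r //.
  by rewrite subr0.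
- by move=> e; rewrite uE qpi.
- by move=> w; have [[d e] <-] := pis w; exists d, e.
Qed.

(** Kernels of a composite: Ker (g2 o g1) is an extension of Ker g2 by Ker g1. *)
Lemma short_exact_epi_comp K1 K2 B1 B2 C (k1 : {linear K1 -> B1}) (g1 : {linear B1 -> B2})
    (k2 : {linear K2 -> B2}) (g2 : {linear B2 -> C}) :
  short_exact k1 g1 -> short_exact k2 g2 ->
  exists (K : lmodType T) (k : {linear K -> B1}) (a : {linear K1 -> K}) (b : {linear K -> K2}),
    [/\ short_exact k (g2 \o g1 : {linear B1 -> C}), short_exact a b &
     forall x, k (a x) = k1 x].
Proof.
move=> [k1i ex1 g1s] [k2i ex2 g2s].
have g21s : surjective_map (g2 \o g1 : {linear B1 -> C}).
  by move=> z; have [y <-] := g2s z; have [x <-] := g1s y; exists x.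
have [k [ki kex _]] := kernel_short_exact g21s.
have [|a aE] := @lift_mono _ _ K1 k k1 ki.
  by move=> x; apply/kex; rewrite /= (exact_comp0 ex1) linear0.
have [|b bE] := @lift_mono _ _ (kernel (g2 \o g1 : {linear B1 -> C})) k2
  (g1 \o k : {linear _ -> B2}) k2i.
  move=> x; apply/ex2; exact: (exact_comp0 kex x).
exists (kernel (g2 \o g1 : {linear B1 -> C})), k, a, b; split=> //; split.
- by move=> x y /(congr1 k); rewrite !aE => /k1i.
- move=> x; split=> [bx|[y <-]].
    have /ex1[y yE] : g1 (k x) = 0 by have := bE x; rewrite bx linear0 /=.
    by exists y; apply: ki; rewrite aE.
  by apply: k2i; rewrite bE /= aE linear0 (exact_comp0 ex1).
- move=> z; have [y yE] := g1s (k2 z).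
  have /kex[x xE] : (g2 \o g1 : {linear _ -> _}) y = 0 by rewrite /= yE (exact_comp0 ex2).
  by exists x; apply: k2i; rewrite bE /= xE.
Qed.

(** Cokernels of a composite: Coker (f2 o f1) is an extension of Coker f2 by
    Coker f1. *)
Lemma short_exact_mono_comp A B1 B2 Q1 Q2 (f1 : {linear A -> B1}) (p1 : {linear B1 -> Q1})
    (f2 : {linear B1 -> B2}) (p2 : {linear B2 -> Q2}) :
  short_exact f1 p1 -> short_exact f2 p2 ->
  exists (Q : lmodType T) (p : {linear B2 -> Q}) (a : {linear Q1 -> Q}) (b : {linear Q -> Q2}),
    short_exact (f2 \o f1 : {linear A -> B2}) p /\ short_exact a b.
Proof.
move=> [f1i ex1 p1s] [f2i ex2 p2s].
have f21i : injective_map (f2 \o f1 : {linear A -> B2}) by move=> x y /f2i/f1i.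
have [p [_ pex ps]] := cokernel_short_exact f21i.
have [|a aE] := @descend_epi _ _ (cokernel (f2 \o f1 : {linear A -> B2})) p1
   (p \o f2 : {linear _ -> _}) p1s.
  by move=> x /ex1[y <-]; exact: (exact_comp0 pex).
have [|b bE] := @descend_epi _ _ Q2 p p2 ps.
  by move=> x /pex[y <-]; exact: (exact_comp0 ex2).
exists (cokernel (f2 \o f1 : {linear A -> B2})), p, a, b; split=> //; split.
- apply: injective_map0 => y; have [x <-] := p1s y; rewrite aE /= => /pex[z /= /f2i <-].
  exact: exact_comp0.
- move=> y; have [x <-] := ps y; rewrite bE; split=> [/ex2[z <-]|[z]].
    by exists (p1 z); rewrite aE.
  by have [w <-] := p1s z; rewrite aE /= -bE => <-; rewrite bE (exact_comp0 ex2).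
- by move=> z; have [x <-] := p2s z; exists (p x).
Qed.

End Linear.

(** * Linear maps out of a tensor product, and free modules *)

Section TensorLinear.
Context {R S : pzRingType} (M : bimodType R S).

Lemma tensor_lift_linear (Y : lmodType S) (V : lmodType R) (b : M -> Y -> V) :
  balanced b -> (forall r m y, b (r *: m) y = r *: b m y) ->
  exists f : {linear tensor M Y -> V}, forall m y, f (tens m y) = b m y.
Proof.
move=> bP bZ; have lB := tensor_liftB bP.
have lZ a : tensor_lift b \o ( *:%R a) =1 ( *:%R a) \o tensor_lift b.
  apply: tensor_hom_ext => [x y|x y|m y] /=; rewrite ?scalerBr ?lB ?scalerBr //.
  by rewrite [_ *: tens _ _]tensor_scale_tens !tensor_lift_tens.
have [|f fE] := @linear_of_fun _ (tensor M Y) V (tensor_lift b).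
  move=> a x y; have -> : a *: x + y = a *: x - (0 - y) by rewrite sub0r opprK.
  have l0 : tensor_lift b 0 = 0 by have := lB 0 0; rewrite !subrr.
  by rewrite !lB l0 sub0r opprK [tensor_lift b (a *: x)]lZ.
by exists f => m y; rewrite fE tensor_lift_tens.
Qed.

Lemma tensor_linear_ext (Y : lmodType S) (V : lmodType R) (f g : {linear tensor M Y -> V}) :
  (forall m y, f (tens m y) = g (tens m y)) -> f =1 g.
Proof. by apply: tensor_hom_ext => x y; rewrite linearB. Qed.

End TensorLinear.

(** T as a T-Z-bimodule, so that free T-modules are T (x)_Z Z[A] and inherit
    their universal property from the tensor product. *)
Definition zregular (T : pzRingType) : Type := T^o.
HB.instance Definition _ T := GRing.Lmodule.on (zregular T).

Section ZRegular.
Context {T : pzRingType}.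
Definition zregular_scale (m : zregular T) (n : int) : zregular T := m *~ n.
Fact zregular_scaleDl m m' n :
  zregular_scale (m + m') n = zregular_scale m n + zregular_scale m' n.
Proof. exact: mulrzDl. Qed.
Fact zregular_scaleDr m n n' :
  zregular_scale m (n + n') = zregular_scale m n + zregular_scale m n'.
Proof. exact: mulrzDr. Qed.
Fact zregular_scaleA m n n' :
  zregular_scale (zregular_scale m n) n' = zregular_scale m (n * n').
Proof. by rewrite /zregular_scale mulrzA. Qed.
Fact zregular_scale1 m : zregular_scale m 1 = m.
Proof. by []. Qed.
Fact zregular_scaleAl (r : T) m n : zregular_scale (r *: m) n = r *: zregular_scale m n.
Proof. by rewrite /zregular_scale scalerMzr. Qed.
HB.instance Definition _ := Lmodule_isBimodule.Build T int (zregular T)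
  zregular_scaleDl zregular_scaleDr zregular_scaleA zregular_scale1 zregular_scaleAl.

Section FreeModule.
Context (A : choiceType).
Definition free_mod : Type := tensor (zregular T) {freeg A / int}.
HB.instance Definition _ := GRing.Lmodule.on free_mod.

Definition free_gen (a : A) : free_mod := tens (1 : zregular T) (<< a >> : {freeg A / int}).

Lemma free_lift (V : lmodType T) (h : A -> V) :
  exists f : {linear free_mod -> V}, forall a, f (free_gen a) = h a.
Proof.
pose hz (y : {freeg A / int}) : V := fglift (h : A -> zmodule V) y.
have hzB : zmod_morphism hz.
  by move=> g k; exact: (lift_is_additive (M := zmodule V)).
pose F := GRing.isZmodMorphism.Build _ V hz hzB.
pose hz' : {additive {freeg A / int} -> V} := HB.pack hz F.
have hE y : hz y = hz' y by [].
have [|r m y|f fE] := @tensor_lift_linear _ _ (zregular T) {freeg A / int} V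
  (fun (t : zregular T) y => (t : T) *: hz y).
- split=> [m m' y|m y y'|m s y]; first exact: scalerDl.
    by rewrite !hE raddfD scalerDr.
  have -> : hz (s *: y) = hz y *~ s.
    by rewrite -[s in LHS]intz scaler_int !hE raddfMz.
  by rewrite [m ·r s]/(m *~ s) -scalerMzr scalerMzl.
- by rewrite scalerA.
exists f => a; by rewrite fE scale1r /hz liftU scale1r.
Qed.

Lemma free_ext (V : lmodType T) (f g : {linear free_mod -> V}) :
  (forall a, f (free_gen a) = g (free_gen a)) -> f =1 g.
Proof.
move=> fg; apply: tensor_linear_ext => m y.
rewrite -(freeg_sumE y).
have tD : zmod_morphism (tens m : {freeg A / int} -> tensor (zregular T) {freeg A / int}).
  move=> u v; apply/eqP; rewrite eq_sym subr_eq -tensDr; apply/eqP.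
  by rewrite subrK.
pose F := GRing.isZmodMorphism.Build _ _ (tens m) tD.
pose t' : {additive {freeg A / int} -> tensor (zregular T) {freeg A / int}} :=
  HB.pack (tens m) F.
rewrite -[tens m]/(t' : _ -> _) !raddf_sum; apply: eq_bigr => a _.
set c := coeff _ _; have -> : << c *g a >> = << a >> *~ c :> {freeg A / int}.
  by rewrite freegU_mulz intz.
rewrite !raddfMz /=; congr (_ *~ _).
have -> : tens m << a >> = (m : T) *: free_gen a :> free_mod.
  by rewrite [RHS]tensor_scale_tens [_ *: _]mulr1.
by rewrite !linearZ fg.
Qed.

Lemma free_projective : projective (free_mod : lmodType T).
Proof.
move=> B C g f gs; have [k kP] := choice gs.
have [h hE] := @free_lift B (k \o f \o free_gen).
exists h; apply: (@free_ext C (g \o h : {linear _ -> _})) => a /=.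
by rewrite hE kP.
Qed.
End FreeModule.

Definition cover (A : lmodType T) : lmodType T := free_mod A.

Lemma cover_epi (A : lmodType T) : exists p : {linear cover A -> A}, surjective_map p.
Proof.
have [p pE] := @free_lift A A id.
by exists p => a; exists (free_gen a).
Qed.

End ZRegular.

(** * Resolutions, coresolutions, and the classes of objects they define *)

Section Resolutions.
Context {T : pzRingType}.
Implicit Types A B C D E F K L P Q W : lmodType T.

Section Splice.
Context A K P (k : {linear K -> P}) (p : {linear P -> A}) (kp : short_exact k p).

Section Res.
Context (r : resolution K).
Definition splice_ob i : lmodType T := if i is j.+1 then r j else P.
Definition splice_d i : {linear splice_ob i.+1 -> splice_ob i} :=
  match i with
  | 0%N => k \o res_aug r : {linear _ -> _}
  | j.+1 => res_d r j
  end.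
Fact splice_exact0 : exact_at (splice_d 0) p.
Proof.
have [ki ex _] := kp; move=> y; split=> [/ex[x <-]|[x <-]]; last exact: (exact_comp0 ex).
by have [z <-] := res_aug_surj r x; exists z.
Qed.
Fact splice_exact i : exact_at (splice_d i.+1) (splice_d i).
Proof.
case: i => [|i]; last exact: (@res_exact _ _ r i).
move=> y; rewrite -(@res_exact0 _ _ r) /=; have [ki _ _] := kp.
split=> [|->]; last exact: linear0.
by rewrite -(linear0 k) => /ki.
Qed.
Definition splice : resolution A :=
  @Resolution T A splice_ob splice_d p (let: And3 _ _ s := kp in s)
    splice_exact0 splice_exact.
End Res.
End Splice.

Section Cosplice.
Context A K P (k : {linear A -> P}) (p : {linear P -> K}) (kp : short_exact k p).

Context (r : coresolution K).
Definition cosplice_ob i : lmodType T := if i is j.+1 then r j else P.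
Definition cosplice_d i : {linear cosplice_ob i -> cosplice_ob i.+1} :=
  match i with
  | 0%N => cores_aug r \o p : {linear _ -> _}
  | j.+1 => cores_d r j
  end.
Fact cosplice_exact0 : exact_at k (cosplice_d 0).
Proof.
have [ki ex _] := kp; move=> y; rewrite -ex /=; split=> [|->]; last exact: linear0.
by rewrite -(linear0 (cores_aug r)) => /(@cores_aug_inj _ _ r).
Qed.
Fact cosplice_exact i : exact_at (cosplice_d i) (cosplice_d i.+1).
Proof.
case: i => [|i]; last exact: (@cores_exact _ _ r i).
move=> y; have [_ _ ps] := kp; rewrite (@cores_exact0 _ _ r) /=; split=> -[x <-].
  by have [z <-] := ps x; exists z.
by exists (p x).
Qed.
Definition cosplice : coresolution A :=
  @Coresolution T A cosplice_ob cosplice_d k (let: And3 i _ _ := kp in i)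
    cosplice_exact0 cosplice_exact.
End Cosplice.

(** The augmentation of the resolution r[1..] of the first syzygy K. *)
Lemma res_shift A K (r : resolution A) (k : {linear K -> r 0%N}) :
  short_exact k (res_aug r) ->
  exists q : {linear r 1%N -> K}, [/\ surjective_map q, exact_at (res_d r 1) q
    & forall x, k (q x) = res_d r 0 x].
Proof.
move=> [ki ex _].
have [|q qE] := @lift_mono _ _ _ (r 1%N) k (res_d r 0) ki.
  by move=> x; apply/ex; exact: (exact_comp0 (@res_exact0 _ _ r)).
exists q; split=> //.
- move=> y; have /(@res_exact0 _ _ r)[x xE] := exact_comp0 ex y.
  by exists x; apply: ki; rewrite qE.
- move=> y; rewrite -(@res_exact _ _ r 0) -qE; split=> [->|]; first exact: linear0.
  by rewrite -(linear0 k) => /ki.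
Qed.

Lemma cores_shift A (r : coresolution A) :
  exists (K : lmodType T) (p : {linear r 0%N -> K}) (q : {linear K -> r 1%N}),
    [/\ short_exact (cores_aug r) p, injective_map q, exact_at q (cores_d r 1)
      & forall x, q (p x) = cores_d r 0 x].
Proof.
have [p pe] := cokernel_short_exact (@cores_aug_inj _ _ r).
have [_ ex ps] := pe.
have [|q qE] := @descend_epi _ _ (cokernel (cores_aug r)) (r 1%N) p (cores_d r 0) ps.
  by move=> x /ex[y <-]; exact: (exact_comp0 (@cores_exact0 _ _ r)).
exists (cokernel (cores_aug r)), p, q; split=> //.
- apply: injective_map0 => y; have [x <-] := ps y; rewrite qE.
  by move=> /(@cores_exact0 _ _ r) ?; apply/ex.
- move=> y; rewrite (@cores_exact _ _ r 0); split=> -[x <-]; first by exists (p x).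
  by have [z <-] := ps x; exists z.
Qed.

(** The kernel of the identity serves as a zero module over any ring. *)
Definition zero_mod : lmodType T := kernel (idfun : {linear T^o -> T^o}).
Lemma zero_modP : is_zero_mod zero_mod.
Proof. by move=> x; apply: val_inj; have := valP x; rewrite unfold_in => /eqP. Qed.

Lemma short_exact_id0 A Z : is_zero_mod Z ->
  short_exact (\0%R : {linear Z -> A}) (idfun : {linear A -> A}).
Proof.
move=> Z0; split=> [x y _|y|y]; first by rewrite (Z0 x) (Z0 y).
  by split=> [/= y0|[x <-]] //; exists 0; rewrite y0.
by exists y.
Qed.
Lemma short_exact_0id A Z : is_zero_mod Z ->
  short_exact (idfun : {linear A -> A}) (\0%R : {linear A -> Z}).
Proof.
move=> Z0; split=> [x y //|y|y]; first by split=> // _; exists y.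
by exists 0; rewrite (Z0 y).
Qed.

Lemma zero_resolution : exists r : resolution zero_mod, forall i, is_zero_mod (r i).
Proof.
have e0 (f g : {linear zero_mod -> zero_mod}) : exact_at f g.
  by move=> y; split=> _; [exists 0; rewrite (zero_modP y) linear0 | exact: zero_modP].
have s : surjective_map (\0%R : {linear zero_mod -> zero_mod}).
  by move=> y; exists 0; rewrite (zero_modP y).
by exists (@Resolution _ zero_mod (fun=> zero_mod) (fun=> \0%R) \0%R s (e0 _ _)
  (fun=> e0 _ _)) => i; exact: zero_modP.
Qed.
Lemma zero_coresolution : exists r : coresolution zero_mod, forall i, is_zero_mod (r i).
Proof.
have e0 (f g : {linear zero_mod -> zero_mod}) : exact_at f g.
  by move=> y; split=> _; [exists 0; rewrite (zero_modP y) linear0 | exact: zero_modP].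
have s : injective_map (\0%R : {linear zero_mod -> zero_mod}).
  by move=> x y; rewrite (zero_modP x) (zero_modP y).
by exists (@Coresolution _ zero_mod (fun=> zero_mod) (fun=> \0%R) \0%R s (e0 _ _)
  (fun=> e0 _ _)) => i; exact: zero_modP.
Qed.

Section Wedge.
Context (cC : mod_class T).

Lemma wedge_of_class m A : cC A -> wedge cC m A.
Proof.
move=> CA; have [r r0] := zero_resolution.
exists 0%N, (splice (short_exact_id0 A zero_modP) r); split=> // -[|i] //= _; exact: r0.
Qed.

Lemma wedge_step m A K C (f : {linear K -> C}) (g : {linear C -> A}) :
  short_exact f g -> cC C -> wedge cC m K -> wedge cC m.+1 A.
Proof.
move=> fg CC [k [r [km rC r0]]]; exists k.+1, (splice fg r); split=> //.
  by case=> [|i] //= ik; exact: rC.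
by case=> [|i] //= ik; exact: r0.
Qed.

Lemma vee_of_class m A : cC A -> vee cC m A.
Proof.
move=> CA; have [r r0] := zero_coresolution.
exists 0%N, (cosplice (short_exact_0id A zero_modP) r); split=> // -[|i] //= _; exact: r0.
Qed.

Lemma vee_step m A K C (f : {linear A -> C}) (g : {linear C -> K}) :
  short_exact f g -> cC C -> vee cC m K -> vee cC m.+1 A.
Proof.
move=> fg CC [k [r [km rC r0]]]; exists k.+1, (cosplice fg r); split=> //.
  by case=> [|i] //= ik; exact: rC.
by case=> [|i] //= ik; exact: r0.
Qed.

Context (admC : admissible cC).

Lemma wedge_class0 A : wedge cC 0 A -> cC A.
Proof.
case=> k [r [k0 rC r0]]; apply: (admC.2) (rC 0%N (leq0n _)).
apply: (bij_iso (f := res_aug r)); last exact: res_aug_surj.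
apply: injective_map0 => x /(@res_exact0 _ _ r)[y <-].
by rewrite (r0 1%N _ y) ?linear0 // ltnS.
Qed.

(** A resolution of length 0 is also one of length at most m.+1 whose first
    syzygy is 0; this is where 0 has to belong to the class. *)
Lemma wedge_inv m A : wedge cC m.+1 A ->
  exists (K C : lmodType T) (f : {linear K -> C}) (g : {linear C -> A}),
    [/\ short_exact f g, cC C & wedge cC m K].
Proof.
case=> k [r [km rC r0]].
have [f fe] := kernel_short_exact (@res_aug_surj _ _ r).
exists (kernel (res_aug r)), (r 0%N), f, (res_aug r); split=> //; first exact: rC.
have [q [qs q0 _]] := res_shift fe.
(* k.-1 rather than k: for k = 0 the term r 1 is zero, hence in the class. *)
exists k.-1, (@Resolution _ _ (fun i => r i.+1) (fun i => res_d r i.+1) q qs q0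
  (fun i => @res_exact _ _ r i.+1)); split=> [|i ik|i ik] /=.
- by case: (k) km.
- have [ik'|ik'] := leqP i.+1 k; first exact: rC.
  by apply: admC.1; exact: r0.
- by apply: r0; case: (k) ik.
Qed.

Lemma vee_class0 A : vee cC 0 A -> cC A.
Proof.
case=> k [r [k0 rC r0]]; apply: (admC.2) (rC 0%N (leq0n _)); apply: iso_sym.
apply: (bij_iso (f := cores_aug r)); first exact: cores_aug_inj.
by move=> y; apply/(@cores_exact0 _ _ r); apply: (r0 1%N); rewrite ltnS.
Qed.

Lemma vee_inv m A : vee cC m.+1 A ->
  exists (C K : lmodType T) (f : {linear A -> C}) (g : {linear C -> K}),
    [/\ short_exact f g, cC C & vee cC m K].
Proof.
case=> k [r [km rC r0]].
have [K [p [q [pe qi q1 qp]]]] := cores_shift r.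
exists (r 0%N), K, (cores_aug r), p; split=> //; first exact: rC.
exists k.-1, (@Coresolution _ _ (fun i => r i.+1) (fun i => cores_d r i.+1) q qi q1
  (fun i => @cores_exact _ _ r i.+1)); split=> [|i ik|i ik] /=.
- by case: (k) km.
- have [ik'|ik'] := leqP i.+1 k; first exact: rC.
  by apply: admC.1; exact: r0.
- by apply: r0; case: (k) ik.
Qed.
End Wedge.

Definition cover_map A : {linear cover A -> A} := projT1 (cid (cover_epi A)).
Lemma cover_map_surj A : surjective_map (cover_map A).
Proof. exact: projT2 (cid (cover_epi A)). Qed.

Fixpoint syzygy A i : lmodType T :=
  if i is j.+1 then kernel (cover_map (syzygy A j)) else A.

(** Cover each syzygy by the free module on its elements. *)
Lemma projective_resolution_exists A : exists P : resolution A, projective_resolution P.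
Proof.
pose d i : {linear cover (syzygy A i.+1) -> cover (syzygy A i)} :=
  (val : kernel (cover_map (syzygy A i)) -> _) \o cover_map (syzygy A i.+1).
have ex0 i : exact_at (d i) (cover_map (syzygy A i)).
  move=> y; split=> [yk|[x <-]] /=; last by case: (cover_map _ x) => z /= /eqP.
  have yk' : y \in ker_pred (cover_map (syzygy A i)) by rewrite unfold_in yk.
  by have [x xE] := @cover_map_surj (syzygy A i.+1) (Sub y yk'); exists x; rewrite /= xE.
have ex i : exact_at (d i.+1) (d i).
  move=> y; rewrite -ex0 /=; split=> [y0|-> //].
  exact: val_inj.
exists (Resolution (@cover_map_surj A) (ex0 0%N) ex) => i; exact: free_projective.
Qed.

End Resolutions.

(** * Vanishing of Ext *)

Section Ext.
Context {T : pzRingType}.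
Implicit Types A B C D E F K L P Q W : lmodType T.

(** The classes of extensions of A by B all vanish, expressed through arbitrary
    presentations of A: in this form it is inherited along short exact sequences
    in A by extending the given map twice ([Ext1_ext_l]). *)
Definition Ext1 A B : Prop :=
  forall K E (i : {linear K -> E}) (p : {linear E -> A}), short_exact i p ->
  forall f : {linear K -> B}, exists g : {linear E -> B}, forall x, g (i x) = f x.

(** Compare the presentation E of A with a projective one: E is a quotient of
    K * P 0, and an extension g to P 0 of the induced map on the first syzygy is
    what makes f + g factor through that quotient. *)
Lemma Ext1_of_Ext_vanishes A B : Ext_vanishes 1 A B -> Ext1 A B.
Proof.
move=> v K E i p [ii ex ps] f; have [P Pp] := projective_resolution_exists A.
have [u uE] := Pp 0%N E A p (res_aug P) ps.
have d0 := @res_exact0 _ _ P; have d1 := @res_exact _ _ P 0.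
have [|c cE] := @lift_mono _ _ _ _ i (u \o res_d P 0 : {linear _ -> _}) ii.
  by move=> x; apply/ex; rewrite /= uE (exact_comp0 d0).
have [|g gE] := v P Pp (f \o c : {linear _ -> _}).
  move=> x /=; rewrite (_ : c _ = 0) ?linear0 //; apply: ii.
  by rewrite cE /= (exact_comp0 d1) !linear0.
have [|s sE] := @linear_of_fun _ (K * P 0%N)%type E (fun z => i z.1 + u z.2).
  by move=> a x y /=; rewrite [i _]linearP [u _]linearP addrACA scalerDr.
have [|h hE] := @linear_of_fun _ (K * P 0%N)%type B (fun z => f z.1 + g z.2).
  by move=> a x y /=; rewrite [f _]linearP [g _]linearP addrACA scalerDr.
have ss : surjective_map s.
  move=> e; have [x xE] := @res_aug_surj _ _ P (p e).
  have /ex[y yE] : p (e - u x) = 0 by rewrite linearB uE xE subrr.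
  by exists (y, x); rewrite sE /= yE subrK.
have [|k kE] := @descend_epi _ _ _ B s h ss.
  move=> [x y]; rewrite sE hE /= => xy0.
  have /d0[z zE] : res_aug P y = 0.
    by rewrite -uE -[u y](addKr (i x)) xy0 addr0 linearN (exact_comp0 ex) oppr0.
  have -> : x = - c z.
    by apply: ii; rewrite linearN cE /= zE; apply/eqP; rewrite -addr_eq0 xy0.
  by rewrite linearN -zE -gE /= addNr.
exists k => x; have -> : i x = s (x, 0) by rewrite sE /= linear0 addr0.
by rewrite kE hE /= linear0 addr0.
Qed.

Lemma Ext_vanishes_of_Ext1 A B : Ext1 A B -> Ext_vanishes 1 A B.
Proof.
move=> e P Pp f f0.
have [k ke] := kernel_short_exact (@res_aug_surj _ _ P).
have [q [qs q0 qE]] := res_shift ke.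
have [|f' f'E] := @descend_epi _ _ _ B q f qs; first by move=> x /q0[y <-].
by have [g gE] := e _ _ _ _ ke f'; exists g => x; rewrite -f'E -gE qE.
Qed.

(** Pull the sequence back along h; a retraction of the pullback onto D turns
    its projection to E into a map that vanishes on D. *)
Lemma Ext1_lift C D E F (d : {linear D -> E}) (g : {linear E -> F}) (h : {linear C -> F}) :
  Ext1 C D -> short_exact d g -> exists s : {linear C -> E}, forall x, g (s x) = h x.
Proof.
move=> e dg; have [W [i [p [u [ip ui sq _ _]]]]] := pullback_ses h dg.
have [r rE] := e _ _ _ _ ip (idfun : {linear D -> D}).
have [ii ex ps] := ip.
pose t : {linear W -> E} := u \- (d \o r).
have tE w : t w = u w - d (r w) by [].
have [|s sE] := @descend_epi _ _ C E p t ps.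
  by move=> w /ex[x <-]; rewrite tE ui rE subrr.
exists s => x; have [w <-] := ps x; have [_ dgex _] := dg.
by rewrite sE tE linearB sq (exact_comp0 dgex) subr0.
Qed.

(** Extending f along i is splitting the pushout of the sequence along f. *)
Lemma Ext1_of_split C D :
  (forall E (i : {linear D -> E}) (p : {linear E -> C}), short_exact i p ->
     exists s : {linear C -> E}, forall x, p (s x) = x) -> Ext1 C D.
Proof.
move=> spl K E i p ip f; have [W [j [q [u [jq uj qu _]]]]] := pushout_ses f ip.
have [s sE] := spl _ _ _ jq; have [ji jex _] := jq.
pose t : {linear W -> W} := idfun \- (s \o q).
have tE w : t w = w - s (q w) by [].
have [|r rE] := @lift_mono _ _ _ W j t ji.
  by move=> w; apply/jex; rewrite tE linearB sE subrr.
exists (r \o u : {linear _ -> _}) => x; apply: ji; rewrite /= rE tE qu uj.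
by have [_ ex _] := ip; rewrite (exact_comp0 ex) linear0 subr0.
Qed.

Lemma Ext1_ext_l A' A A'' B (i : {linear A' -> A}) (p : {linear A -> A''}) :
  short_exact i p -> Ext1 A' B -> Ext1 A'' B -> Ext1 A B.
Proof.
move=> ip e' e'' K E k g kg f.
have [K0 [k0 [a [b [kg0 ab k0a]]]]] := short_exact_epi_comp kg ip.
have [f0 f0E] := e' _ _ _ _ ab f; have [h hE] := e'' _ _ _ _ kg0 f0.
by exists h => x; rewrite -k0a hE f0E.
Qed.

Lemma Ext_vanishes_ext_r j A B1 B B2 (i : {linear B1 -> B}) (p : {linear B -> B2}) :
  short_exact i p -> Ext_vanishes j.+1 A B1 -> Ext_vanishes j.+1 A B2 ->
  Ext_vanishes j.+1 A B.
Proof.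
move=> [ii ex ps] v1 v2 P Pp f f0.
have [|g gE] := v2 P Pp (p \o f : {linear _ -> _}).
  by move=> x; rewrite /= f0 linear0.
have [g' g'E] := Pp j B B2 p g ps.
pose f1 : {linear P j.+1 -> B} := f \- (g' \o res_d P j).
have f1E x : f1 x = f x - g' (res_d P j x) by [].
have [|f2 f2E] := @lift_mono _ _ _ _ i f1 ii.
  by move=> x; apply/ex; rewrite f1E linearB g'E -gE subrr.
have [|h hE] := v1 P Pp f2.
  move=> x; apply: ii; rewrite f2E f1E f0 (exact_comp0 (@res_exact _ _ P j)).
  by rewrite !linear0 addr0.
pose k : {linear P j -> B} := g' \+ (i \o h).
have kE x : k x = g' x + i (h x) by [].
by exists k => x; rewrite kE -hE f2E f1E addrC subrK.
Qed.

Lemma Ext1_ext_r A B1 B B2 (i : {linear B1 -> B}) (p : {linear B -> B2}) :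
  short_exact i p -> Ext1 A B1 -> Ext1 A B2 -> Ext1 A B.
Proof.
move=> ip e1 e2; apply: Ext1_of_Ext_vanishes.
by apply: (Ext_vanishes_ext_r ip); exact: Ext_vanishes_of_Ext1.
Qed.

(** The connecting map of the long exact sequence in the second variable, for a
    fixed projective resolution: lift the cocycle f to B, and correct the lift by
    the cochain g that kills its boundary in B1. *)
Lemma Ext_vanishes_cokernel j A B1 B B2 (i : {linear B1 -> B}) (p : {linear B -> B2}) :
  short_exact i p -> Ext_vanishes j.+1 A B -> Ext_vanishes j.+2 A B1 ->
  Ext_vanishes j.+1 A B2.
Proof.
move=> [ii ex ps] v v1 P Pp f f0.
have [f' f'E] := Pp j.+1 B B2 p f ps.
have [|c cE] := @lift_mono _ _ _ _ i (f' \o res_d P j.+1 : {linear _ -> _}) ii.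
  by move=> x; apply/ex; rewrite /= f'E f0.
have [|g gE] := v1 P Pp c.
  by move=> x; apply: ii; rewrite cE /= (exact_comp0 (@res_exact _ _ P j.+1)) !linear0.
pose f1 : {linear P j.+1 -> B} := f' \- (i \o g).
have f1E x : f1 x = f' x - i (g x) by [].
have [|h hE] := v P Pp f1.
  by move=> x; rewrite f1E -gE cE subrr.
exists (p \o h : {linear _ -> _}) => x /=.
by rewrite -hE f1E linearB f'E (exact_comp0 ex) subr0.
Qed.

(** All syzygies of C stay in the class, and Ext^{i+1}(C, D) is Ext^1 of the i-th
    syzygy. *)
Lemma Ext_vanishes_of_resolving (cC : mod_class T) D :
  closed_ker_epi cC -> (forall P, projective P -> cC P) ->
  (forall C, cC C -> Ext1 C D) -> forall i C, cC C -> Ext_vanishes i.+1 C D.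
Proof.
move=> ker proj e; elim=> [|i IH] C CC; first exact: Ext_vanishes_of_Ext1 (e _ CC).
move=> P Pp f f0; have [k ke] := kernel_short_exact (@res_aug_surj _ _ P).
have CK := ker _ _ (res_aug P) (@res_aug_surj _ _ P) (proj _ (Pp 0%N)) CC.
have [q [qs q0 _]] := res_shift ke.
exact: IH CK (@Resolution _ _ (fun i => P i.+1) (fun i => res_d P i.+1) q qs q0
  (fun i => @res_exact _ _ P i.+1)) (fun i => Pp i.+1) f f0.
Qed.

(** Dimension shift in the second variable: every class in
    Ext^{i+2}(C, D) dies in a suitable overmodule D1 of D that can be chosen in the
    class, so it comes from Ext^{i+1}(C, D1 / D). *)
Lemma Ext_vanishes_of_coresolving (cD : mod_class T) C :
  closed_coker_mono cD ->
  (forall A, exists (D : lmodType T) (f : {linear A -> D}), injective_map f /\ cD D) ->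
  (forall D, cD D -> Ext1 C D) -> forall i D, cD D -> Ext_vanishes i.+1 C D.
Proof.
move=> coker emb e; elim=> [|i IH] D DD; first exact: Ext_vanishes_of_Ext1 (e _ DD).
move=> P Pp f f0.
have [k ke] : exists k : {linear kernel (res_d P i) -> P i.+1},
    [/\ injective_map k, forall x, res_d P i (k x) = 0 &
     forall y, res_d P i y = 0 -> exists x, k x = y].
  have [|k kE] := @linear_of_fun _ (kernel (res_d P i)) (P i.+1)
    (val : kernel (res_d P i) -> _).
    by move=> a x y; rewrite linearP.
  exists k; split=> [x y|x|y y0]; first by rewrite !kE => /val_inj.
    by rewrite kE; case: x => x /= /eqP.
  have yk : y \in ker_pred (res_d P i) by rewrite unfold_in y0.
  by exists (Sub y yk : kernel (res_d P i)); rewrite kE SubK.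
have [ki k0 ks] := ke.
have dex := @res_exact _ _ P i.
have dex1 := @res_exact _ _ P i.+1.
have [c ce] := cokernel_short_exact ki.
(* By exactness the kernel of d i is the image of d i.+1; f' is the map that
   the cocycle f induces on it. *)
have [|q qE] := @lift_mono _ _ _ _ k (res_d P i.+1) ki.
  by move=> x; apply: ks; exact: (exact_comp0 dex).
have [||f' f'E] := @descend_epi _ _ (kernel (res_d P i)) D q f.
- move=> y; have /dex[x xE] := k0 y; by exists x; apply: ki; rewrite qE xE.
- move=> x qx; have /dex1[y <-] : res_d P i.+1 x = 0 by rewrite -qE qx linear0.
  exact: f0.
(* In the pushout W, f becomes the coboundary of u. *)
have [W [j [_ [u [[ji _ _] uj _ _]]]]] := pushout_ses f' ce.
have [D1 [m [mi DD1]]] := emb W.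
have jmi : injective_map (m \o j : {linear D -> D1}) by move=> x y /mi/ji.
have [p [_ pex ps]] := cokernel_short_exact jmi.
have DQ := coker _ _ _ jmi DD DD1.
have mE x : m (u (res_d P i.+1 x)) = m (j (f x)) by rewrite -qE uj f'E.
have [|h hE] := IH _ DQ P Pp (p \o m \o u : {linear _ -> _}).
  by move=> x /=; rewrite mE; exact: (exact_comp0 pex).
(* m u is a coboundary modulo D; subtracting a lift h' of the witness lands
   in D without changing the coboundary. *)
have [h' h'E] := Pp i D1 _ p h ps.
pose t : {linear P i.+1 -> D1} := (m \o u) \- (h' \o res_d P i).
have tE x : t x = m (u x) - h' (res_d P i x) by [].
have [|g gE] := @lift_mono _ _ _ _ (m \o j : {linear D -> D1}) t jmi.
  by move=> x; apply/pex; rewrite tE linearB h'E -hE subrr.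
exists g => x; apply: jmi; rewrite gE tE mE (exact_comp0 dex) linear0 subr0 //.
Qed.

Lemma split_summand A C K (k : {linear K -> C}) (p : {linear C -> A}) :
  short_exact k p -> (exists s : {linear A -> C}, forall x, p (s x) = x) ->
  exists Q : lmodType T, iso_mod (A * Q)%type C.
Proof.
move=> [ki ex ps] [s sE].
exists K; have [|f fE] := @linear_of_fun _ (A * K)%type C (fun x => s x.1 + k x.2).
  by move=> a x y /=; rewrite [s _]linearP [k _]linearP addrACA scalerDr.
apply: (bij_iso (f := f)).
  apply: injective_map0 => -[x y]; rewrite fE /= => xy0.
  have x0 : x = 0.
    by have := congr1 p xy0; rewrite linearD sE (exact_comp0 ex) addr0 linear0.
  by move: xy0; rewrite x0 linear0 add0r -(linear0 k) => /ki ->.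
move=> c; have /ex[x xE] : p (c - s (p c)) = 0 by rewrite linearB sE subrr.
by exists (p c, x); rewrite fE /= xE addrC subrK.
Qed.

Lemma left_cotorsion_projective n (cC cD : mod_class T) P :
  left_cotorsion_pair n cC cD -> projective P -> cC P.
Proof.
case=> summ _ app Pp; have [K [C [f [g [fg CC _]]]]] := app P.
have [_ _ gs] := fg.
have [Q PQ] := split_summand fg (Pp C P g (idfun : {linear P -> P}) gs).
exact: summ PQ CC.
Qed.

End Ext.

(** * Vanishing of Tor *)

Section TensorExact.
Context {R S : pzRingType} (M : bimodType R S).
Implicit Types A B C D E F K L P Q W : lmodType S.

Fact tensor_map_linear A B (g : {linear A -> B}) : linear (tensor_map M g).
Proof.
have [||f fE] := @tensor_lift_linear _ _ M A (tensor M B) (fun m y => tens m (g y)).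
- exact: tensor_map_balanced.
- by move=> r m y; rewrite [RHS]tensor_scale_tens.
have {}fE : tensor_map M g =1 f.
  apply: tensor_hom_ext => [|x y|m y]; last by rewrite fE tensor_map_tens.
    exact: tensor_liftB (tensor_map_balanced M g).
  by rewrite linearB.
by move=> a x y; rewrite !fE linearP.
Qed.
HB.instance Definition _ A B (g : {linear A -> B}) :=
  GRing.isLinear.Build R (tensor M A) (tensor M B) *:%R (tensor_map M g)
    (tensor_map_linear g).

Lemma tensor_map_comp A B C (f : {linear A -> B}) (g : {linear B -> C}) (h : {linear A -> C}) :
  (forall x, g (f x) = h x) ->
  forall t, tensor_map M g (tensor_map M f t) = tensor_map M h t.
Proof.
move=> gf t.
apply: (tensor_linear_ext (f := tensor_map M g \o tensor_map M f : {linear _ -> _})) => m y.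
by rewrite /= !tensor_map_tens gf.
Qed.

Lemma tensor_map_eq0 A B (f : {linear A -> B}) :
  (forall x, f x = 0) -> forall t, tensor_map M f t = 0.
Proof.
move=> f0 t; apply: (tensor_linear_ext (f := tensor_map M f)
  (g := \0%R : {linear _ -> _})) => m y /=.
rewrite tensor_map_tens f0 /=; apply: (addrI (tens m (0 : B))).
by rewrite -tensDr !addr0.
Qed.

Lemma quotmod_pi0 (V : lmodType R) (X : submodClosed V) v :
  quotmod_pi X v = 0 <-> v \in X.
Proof. by rewrite -(linear0 (quotmod_pi X)) quotmod_piP subr0. Qed.

Lemma tensor_map_surj A B (g : {linear A -> B}) :
  surjective_map g -> surjective_map (tensor_map M g).
Proof.
move=> gs t; apply/asboolP/(quotmod_pi0 (im_pred (tensor_map M g))).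
apply: (tensor_linear_ext (g := \0%R : {linear _ -> _})) => m y /=.
apply/quotmod_pi0/asboolP; have [x <-] := gs y.
by exists (tens m x); rewrite /= tensor_map_tens.
Qed.

(** M (x) C is recovered from the cokernel of M (x) f by sending m (x) c to the class of
    m (x) b for any b over c; a tensor killed by M (x) g is therefore zero there. *)
Lemma tensor_right_exact A B C (f : {linear A -> B}) (g : {linear B -> C}) :
  exact_at f g -> surjective_map g -> exact_at (tensor_map M f) (tensor_map M g).
Proof.
move=> ex gs t; split=> [gt|[u <-]] /=; last first.
  rewrite (@tensor_map_comp _ _ _ f g \0%R); first exact: tensor_map_eq0.
  exact: exact_comp0.
have [k kE] := choice gs.
pose pi := quotmod_pi (im_pred (tensor_map M f)) : {linear tensor M B -> _}.
have pE m y y' : g y = g y' -> pi (tens m y) = pi (tens m y').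
  move=> gyy; apply/quotmod_piP/asboolP.
  have /ex[x xE] : g (y - y') = 0 by rewrite linearB gyy subrr.
  exists (tens m x); rewrite /= tensor_map_tens xE; apply/eqP.
  by rewrite eq_sym subr_eq -tensDr subrK.
have [||h hE] := @tensor_lift_linear _ _ M C (quotmod (im_pred (tensor_map M f)))
  (fun m c => pi (tens m (k c))).
- split=> [m m' y|m y y'|m s y].
  + by rewrite tensDl linearD.
  + by rewrite -linearD -tensDr; apply: pE; rewrite linearD !kE.
  + by rewrite tensA; apply: pE; rewrite linearZ /= !kE.
- by move=> r m y; rewrite -linearZ [_ *: tens _ _]tensor_scale_tens.
have hg : h \o tensor_map M g =1 pi.
  apply: (tensor_linear_ext (f := h \o tensor_map M g : {linear _ -> _})) => m y /=.
  by rewrite tensor_map_tens hE; apply: pE; rewrite kE.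
by apply/asboolP/(quotmod_pi0 (im_pred (tensor_map M f))); rewrite -[LHS]hg /= gt linear0.
Qed.

Definition tensor_inj A B (f : {linear A -> B}) : Prop :=
  forall t, tensor_map M f t = 0 -> t = 0.

(** The vanishing of Tor_{j+1}(M, A); the index starts at Tor_1, which is
    failure of exactness of M (x) -, and higher Tor is reached through syzygies of
    all projective presentations. *)
Fixpoint Tor_zero (j : nat) A : Prop :=
  match j with
  | 0%N => forall K E (i : {linear K -> E}) (p : {linear E -> A}),
      short_exact i p -> tensor_inj i
  | j.+1 => forall K P (i : {linear K -> P}) (p : {linear P -> A}),
      projective P -> short_exact i p -> Tor_zero j K
  end.

Lemma tensor_inj_comp A B C (f : {linear A -> B}) (g : {linear B -> C}) (h : {linear A -> C}) :
  (forall x, g (f x) = h x) -> tensor_inj f -> tensor_inj g -> tensor_inj h.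
Proof. by move=> gf fi gi t; rewrite -(tensor_map_comp gf) => /gi/fi. Qed.

Lemma tensor_inj_cancel A B C (f : {linear A -> B}) (g : {linear B -> C}) (h : {linear A -> C}) :
  (forall x, g (f x) = h x) -> tensor_inj h -> tensor_inj f.
Proof. by move=> gf hi t ft; apply: hi; rewrite -(tensor_map_comp gf) ft linear0. Qed.

Lemma tensor_inj_id A (f : {linear A -> A}) : (forall x, f x = x) -> tensor_inj f.
Proof.
move=> fE t; suff -> : tensor_map M f t = t by [].
apply: (tensor_linear_ext (f := tensor_map M f) (g := idfun : {linear _ -> _})) => m y /=.
by rewrite tensor_map_tens fE.
Qed.

Lemma split_retraction K E A (i : {linear K -> E}) (p : {linear E -> A}) :
  short_exact i p -> (exists s : {linear A -> E}, forall x, p (s x) = x) ->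
  exists r : {linear E -> K}, forall x, r (i x) = x.
Proof.
move=> [ii ex ps] [s sE]; pose t : {linear E -> E} := idfun \- (s \o p).
have [|r rE] := @lift_mono _ _ _ E i t ii.
  by move=> x; apply/ex; rewrite /t /= linearB sE subrr.
by exists r => x; apply: ii; rewrite rE /t /= (exact_comp0 ex) linear0 subr0.
Qed.

Lemma projective_retraction K E P (i : {linear K -> E}) (p : {linear E -> P}) :
  projective P -> short_exact i p ->
  exists r : {linear E -> K}, forall x, r (i x) = x.
Proof.
move=> Pp ip; apply: (split_retraction ip); have [_ _ ps] := ip.
by have [s sE] := Pp E P p (idfun : {linear P -> P}) ps; exists s.
Qed.

Lemma projective_kernel K Q P (i : {linear K -> Q}) (p : {linear Q -> P}) :
  projective Q -> projective P -> short_exact i p -> projective K.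
Proof.
move=> Qp Pp ip A B g f gs; have [r rE] := projective_retraction Pp ip.
have [h hE] := Qp A B g (f \o r : {linear _ -> _}) gs.
by exists (h \o i : {linear _ -> _}) => x; rewrite /= hE /= rE.
Qed.

Lemma Tor_zero_projective j P : projective P -> Tor_zero j P.
Proof.
elim: j P => [|j IH] P Pp K E i p; last first.
  by move=> Ep ip; apply: IH; exact: projective_kernel ip.
move=> ip; have [r rE] := projective_retraction Pp ip.
by apply: (tensor_inj_cancel (h := idfun)) rE _; apply: tensor_inj_id.
Qed.

(** Diagram chase in the cross of the two presentations with pullback W: an
    element of M (x) K killed in M (x) E comes, in M (x) W, from M (x) L, where it must
    vanish since its image in M (x) F does. *)
Lemma Tor_zero0_of_presentation L F A (l : {linear L -> F}) (h : {linear F -> A}) :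
  short_exact l h -> tensor_inj l -> Tor_zero 0 F -> Tor_zero 0 A.
Proof.
move=> lh linj tF K E k g kg t kt.
have [W [i [p [j [u [ip ju ui pj]]]]]] := pullback_cross kg lh.
have [_ jex us] := ju.
apply: (tF _ _ _ _ ip).
have /(tensor_right_exact jex us)[w wE] : tensor_map M u (tensor_map M i t) = 0.
  by rewrite (tensor_map_comp ui).
have [_ iex _] := ip.
suff w0 : w = 0 by rewrite -wE w0 linear0.
apply: linj; rewrite -(tensor_map_comp pj) wE (@tensor_map_comp _ _ _ i p \0%R).
  exact: tensor_map_eq0.
exact: exact_comp0.
Qed.

(** Two pieces of the long exact sequence of Tor, for arbitrary sequences.  Each
    step uses kernels of the composite Q -> B -> C with Q projective, which give
    an exact sequence 0 -> Omega B -> Omega C -> A -> 0; thus the shift for j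
    yields the closure under extensions for j + 1, and both yield the shift for
    j + 1. *)
Lemma Tor_zero_shift j :
  (forall A B C (f : {linear A -> B}) (g : {linear B -> C}),
     short_exact f g -> Tor_zero j.+1 C -> Tor_zero j B -> Tor_zero j A) /\
  (forall A B C (f : {linear A -> B}) (g : {linear B -> C}),
     short_exact f g -> Tor_zero j A -> Tor_zero j C -> Tor_zero j B).
Proof.
elim: j => [|j [IHS IHE]].
  split=> A B C f g fg tA tC; last first.
    move=> K E k p kp.
    have [K0 [k0 [a [b [kg0 ab k0a]]]]] := short_exact_epi_comp kp fg.
    by apply: tensor_inj_comp k0a _ _; [exact: tA ab | exact: tC kg0].
  have [Q [p [Qp ps]]] : exists Q (p : {linear Q -> B}), projective Q /\ surjective_map p.
    by have [p ps] := cover_epi B; exists (cover B), p; split=> //; exact: free_projective.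
  have [k kp] := kernel_short_exact ps.
  have [K0 [k0 [a [b [kg0 ab k0a]]]]] := short_exact_epi_comp kp fg.
  apply: (Tor_zero0_of_presentation ab); last exact: tA Qp kg0.
  by apply: (tensor_inj_cancel k0a); exact: tC kp.
have IHE' A B C (f : {linear A -> B}) (g : {linear B -> C}) :
    short_exact f g -> Tor_zero j.+1 A -> Tor_zero j.+1 C -> Tor_zero j.+1 B.
  move=> fg tA tC K P k p Pp kp.
  have [K0 [k0 [a [b [kg0 ab k0a]]]]] := short_exact_epi_comp kp fg.
  exact: IHS ab tA (tC _ _ _ _ Pp kg0).
split=> // A B C f g fg tC tB K P k p Pp kp.
have [Q [q [Qp qs]]] : exists Q (q : {linear Q -> B}), projective Q /\ surjective_map q.
  by have [q qs] := cover_epi B; exists (cover B), q; split=> //; exact: free_projective.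
have [l lq] := kernel_short_exact qs.
have [K0 [k0 [a [b [kg0 ab k0a]]]]] := short_exact_epi_comp lq fg.
have [W [i [p' [i' [u [ip iu _ _]]]]]] := pullback_cross kp ab.
apply: (IHS _ _ _ _ _ ip); first exact: tC Qp kg0.
by apply: (IHE _ _ _ _ _ iu); [exact: tB Qp lq | exact: Tor_zero_projective].
Qed.

(** A projective resolution of a syzygy splices into one of A. *)
Lemma Tor_zero_of_Tor_vanishes j A : Tor_vanishes j.+1 M A -> Tor_zero j A.
Proof.
elim: j A => [|j IH] A v; last first.
  move=> K P i p Pp ip; apply: IH => Q Qp t.
  exact: (v (splice ip Q) (fun n => match n with 0%N => Pp | n'.+1 => Qp n' end)).
have [P Pp] := projective_resolution_exists A.
have [k ke] := kernel_short_exact (@res_aug_surj _ _ P).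
have [q [qs q0 qE]] := res_shift ke.
apply: (Tor_zero0_of_presentation ke); last exact: Tor_zero_projective.
move=> t kt; have [s sE] := tensor_map_surj qs t.
have [|u uE] := v P Pp s; first by rewrite -(tensor_map_comp qE) sE.
rewrite -sE -uE /= (@tensor_map_comp _ _ _ (res_d P 1) q \0%R).
  exact: tensor_map_eq0.
exact: exact_comp0.
Qed.

Lemma tensor_short_exact A B C (f : {linear A -> B}) (g : {linear B -> C}) :
  short_exact f g -> Tor_zero 0 C ->
  short_exact (tensor_map M f : {linear tensor M A -> tensor M B}) (tensor_map M g).
Proof.
move=> fg tC; have [_ ex gs] := fg; split.
- by apply: injective_map0 => t; exact: (tC _ _ _ _ fg).
- exact: tensor_right_exact.
- exact: tensor_map_surj.
Qed.

End TensorExact.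

(** * The triangular matrix ring *)

Section TriangularElements.
Context {R S : pzRingType} {M : bimodType R S}.
Local Notation Lam := (triring M).

Definition tR (r : R) : Lam := (r, 0, 0).
Definition tM (m : M) : Lam := (0, m, 0).
Definition tS (s : S) : Lam := (0, 0, s).

Lemma rscale0r (m : M) : m ·r (0 : S) = 0.
Proof. by apply: (addrI (m ·r 0)); rewrite -rscaleDr !addr0. Qed.

Let tri_simp := (mulr0, mul0r, mulr1, scaler0, scale0r, @rscale0l R S M,
  rscale0r, @rscale1 R S M, addr0, add0r).

Lemma tri1E : 1 = tR 1 + tS 1.
Proof. by congr (_, _, _); rewrite /= ?tri_simp. Qed.
Lemma tRR r r' : tR (r * r') = tR r * tR r'.
Proof. by congr (_, _, _); rewrite /= !tri_simp. Qed.
Lemma tSS s s' : tS (s * s') = tS s * tS s'.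
Proof. by congr (_, _, _); rewrite /= !tri_simp. Qed.
Lemma tRM r m : tR r * tM m = tM (r *: m).
Proof. by congr (_, _, _); rewrite /= !tri_simp. Qed.
Lemma tMS m s : tM m * tS s = tM (m ·r s).
Proof. by congr (_, _, _); rewrite /= !tri_simp. Qed.
Lemma tRS r s : tR r * tS s = 0.
Proof. by congr (_, _, _); rewrite /= !tri_simp. Qed.
Lemma tSR s r : tS s * tR r = 0.
Proof. by congr (_, _, _); rewrite /= !tri_simp. Qed.
Lemma tri_tR1 (a : Lam) : a * tR 1 = tR a.1.1.
Proof. by case: a => [[r m] s]; congr (_, _, _); rewrite /= ?tri_simp. Qed.
Lemma tri_tS1 (a : Lam) : a * tS 1 = tM a.1.2 + tS a.2.
Proof. by case: a => [[r m] s]; congr (_, _, _); rewrite /= ?tri_simp. Qed.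
Lemma tR1_tri (a : Lam) : tR 1 * a = tR a.1.1 + tM a.1.2.
Proof.
by case: a => [[r m] s]; congr (_, _, _); rewrite /= ?mul1r ?scale1r ?tri_simp.
Qed.
Lemma tS1_tri (a : Lam) : tS 1 * a = tS a.2.
Proof. by case: a => [[r m] s]; congr (_, _, _); rewrite /= ?mul1r ?tri_simp. Qed.
Lemma tRD r r' : tR (r + r') = tR r + tR r'.
Proof. by congr (_, _, _); rewrite /= !tri_simp. Qed.
Lemma tMD m m' : tM (m + m') = tM m + tM m'.
Proof. by congr (_, _, _); rewrite /= !tri_simp. Qed.
Lemma tSD s s' : tS (s + s') = tS s + tS s'.
Proof. by congr (_, _, _); rewrite /= !tri_simp. Qed.

End TriangularElements.

(** * Corners of modules along a non-unital ring map *)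

(** The entries of a triangular matrix ring embed additively and
    multiplicatively, but do not preserve the unit; restricting scalars along
    such an embedding yields a unitary module only after cutting down to the
    part fixed by the image of 1. *)
Record nonunital_map (Q L : pzRingType) := NonunitalMap {
  nu_fun :> Q -> L;
  nuD : forall a b, nu_fun (a + b) = nu_fun a + nu_fun b;
  nuM : forall a b, nu_fun (a * b) = nu_fun a * nu_fun b
}.

Section Corner.
Context {Q L : pzRingType} (j : nonunital_map Q L).

Section Module.
Context (A : lmodType L).

Definition corner_pred : {pred A} := fun x => j 1 *: x == x.
Fact corner_pred_closed : zmod_closed corner_pred.
Proof.
split=> [|x y]; rewrite !unfold_in ?scaler0 // => /eqP x1 /eqP y1.
by rewrite scalerBr x1 y1.
Qed.
HB.instance Definition _ := GRing.isZmodClosed.Build A corner_pred corner_pred_closed.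

Record corner := Corner {corner_val :> A; _ : corner_val \in corner_pred}.
HB.instance Definition _ := [isSub for corner_val].
HB.instance Definition _ := [Choice of corner by <:].
HB.instance Definition _ := [SubChoice_isSubZmodule of corner by <:].

Lemma cornerP (x : corner) : j 1 *: val x = val x.
Proof. by have := valP x; rewrite unfold_in => /eqP. Qed.

Fact corner_scale_subproof q (x : A) : j q *: x \in corner_pred.
Proof. by rewrite unfold_in scalerA -nuM mul1r. Qed.
Definition corner_scale (q : Q) (x : corner) : corner :=
  Corner (corner_scale_subproof q (val x)).
Fact corner_scaleA a b x : corner_scale a (corner_scale b x) = corner_scale (a * b) x.
Proof. by apply: val_inj; rewrite /= scalerA -nuM. Qed.
Fact corner_scale1 : left_id 1 corner_scale.
Proof. by move=> x; apply: val_inj; rewrite /= cornerP. Qed.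
Fact corner_scaleDr : right_distributive corner_scale +%R.
Proof. by move=> a x y; apply: val_inj; rewrite /= scalerDr. Qed.
Fact corner_scaleDl x : {morph corner_scale^~ x : a b / a + b}.
Proof. by move=> a b; apply: val_inj; rewrite /= nuD scalerDl. Qed.
HB.instance Definition _ := GRing.Zmodule_isLmodule.Build Q corner
  corner_scaleA corner_scale1 corner_scaleDr corner_scaleDl.

Definition to_corner (x : A) : corner := Corner (corner_scale_subproof 1 x).
Lemma to_cornerD x y : to_corner (x + y) = to_corner x + to_corner y.
Proof. by apply: val_inj; rewrite /= scalerDr. Qed.
Lemma to_corner_val (x : corner) : to_corner (val x) = x.
Proof. by apply: val_inj; rewrite /= cornerP. Qed.

End Module.

Section Map.
Context (A B : lmodType L) (f : {linear A -> B}).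
Fact corner_map_subproof (x : corner A) : f (val x) \in @corner_pred B.
Proof. by rewrite unfold_in -linearZ cornerP. Qed.
Definition corner_map (x : corner A) : corner B := Corner (corner_map_subproof x).
Fact corner_map_linear : linear corner_map.
Proof. by move=> a x y; apply: val_inj; rewrite /= linearD linearZ. Qed.
HB.instance Definition _ := GRing.isLinear.Build Q (corner A) (corner B) *:%R
  corner_map corner_map_linear.
Lemma to_corner_map x : to_corner (f x) = corner_map (to_corner x).
Proof. by apply: val_inj; rewrite /= linearZ. Qed.
End Map.

Implicit Types A B C : lmodType L.

(** Taking corners is exact since multiplication by the image of 1 retracts a
    module onto its corner. *)
Lemma corner_short_exact A B C (f : {linear A -> B}) (g : {linear B -> C}) :
  short_exact f g ->
  short_exact (corner_map f : {linear corner A -> corner B}) (corner_map g).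
Proof.
move=> [fi ex gs]; split.
- by move=> x y /(congr1 val)/fi/val_inj.
- move=> y; split=> [/(congr1 val)/ex[x xE]|[x <-]].
    by exists (to_corner x); rewrite /= -to_corner_map xE to_corner_val.
  by apply: val_inj; rewrite /= (exact_comp0 ex).
- move=> z; have [y yE] := gs (val z); exists (to_corner y).
  by rewrite /= -to_corner_map yE to_corner_val.
Qed.

Lemma corner_iso A B : iso_mod A B -> iso_mod (corner A) (corner B).
Proof.
move=> /iso_maps[f [g [fK gK]]]; exists (corner_map f).
by exists (corner_map g) => x; apply: val_inj; rewrite /= ?fK ?gK.
Qed.

Lemma corner_prod A B : iso_mod (corner A * corner B)%type (corner (A * B)%type).
Proof.
have vP (v : corner A * corner B) :
    ((val v.1, val v.2) : A * B) \in @corner_pred (A * B)%type.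
  by rewrite unfold_in; apply/eqP; congr (_, _); rewrite /= cornerP.
have [|f fE] := @linear_of_fun Q (corner A * corner B)%type (corner (A * B)%type)
  (fun v => Corner (vP v)).
  by move=> a x y; exact: val_inj.
apply: (bij_iso (f := f)) => [[x y] [x' y']|v].
  by rewrite !fE => /(congr1 val)[/val_inj -> /val_inj ->].
have /(congr1 fst) v1 := cornerP v; have /(congr1 snd) v2 := cornerP v.
have w1 : (val v).1 \in @corner_pred A by rewrite unfold_in; apply/eqP.
have w2 : (val v).2 \in @corner_pred B by rewrite unfold_in; apply/eqP.
exists (Corner w1, Corner w2); apply: val_inj; rewrite fE /=.
exact/esym/surjective_pairing.
Qed.

End Corner.

(** * Modules over the triangular matrix ring *)

(** The components of a Lambda-module are its corners along the two diagonal
    embeddings; they depend functorially on the module, with no choice of a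
    triple representing it. *)
Definition upper_embedding {R S : pzRingType} (M : bimodType R S) :
  nonunital_map R (triring M) := NonunitalMap tRD tRR.
Definition lower_embedding {R S : pzRingType} (M : bimodType R S) :
  nonunital_map S (triring M) := NonunitalMap tSD tSS.

Section Components.
Context {R S : pzRingType} {M : bimodType R S}.
Local Notation Lam := (triring M).
Local Notation upper := (corner (upper_embedding M)).
Local Notation lower := (corner (lower_embedding M)).
Local Notation to_upper := (to_corner (upper_embedding M)).
Local Notation to_lower := (to_corner (lower_embedding M)).
Local Notation upper_map := (@corner_map _ _ (upper_embedding M) _ _).
Local Notation lower_map := (@corner_map _ _ (lower_embedding M) _ _).
Implicit Types A B C D E K : lmodType Lam.

Section OneModule.
Context (A : lmodType Lam).

Fact mact_subproof m (x : A) : tM m *: x \in @corner_pred _ _ (upper_embedding M) A.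
Proof. by rewrite unfold_in scalerA tRM scale1r. Qed.
(** The action of the off-diagonal entries, from the lower component to the
    upper one: the structure map phi before passing to the tensor product. *)
Definition mact (m : M) (y : lower A) : upper A := Corner (mact_subproof m (val y)).

Lemma mactDl m m' y : mact (m + m') y = mact m y + mact m' y.
Proof. by apply: val_inj; rewrite /= tMD scalerDl. Qed.
Lemma mactDr m y y' : mact m (y + y') = mact m y + mact m y'.
Proof. by apply: val_inj; rewrite /= scalerDr. Qed.
Lemma mact0 m : mact m 0 = 0.
Proof. by apply: val_inj; rewrite /= scaler0. Qed.
Lemma mactZr m s y : mact (m ·r s) y = mact m (s *: y).
Proof. by apply: val_inj; rewrite /= scalerA tMS. Qed.
Lemma mactZl r m y : mact (r *: m) y = r *: mact m y.
Proof. by apply: val_inj; rewrite /= scalerA tRM. Qed.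

Lemma upper_lowerE (x : A) : x = val (to_upper x) + val (to_lower x).
Proof. by rewrite /= -scalerDl -tri1E scale1r. Qed.

Lemma to_upper_lin (a : Lam) x x' :
  to_upper (a *: x + x') =
    a.1.1 *: to_upper x + mact a.1.2 (to_lower x) + to_upper x' :> upper A.
Proof.
apply: val_inj; rewrite /= !scalerDr !scalerA tR1_tri scalerDl.
by rewrite -tRR mulr1 tMS rscale1.
Qed.
Lemma to_lower_lin (a : Lam) x x' :
  to_lower (a *: x + x') = a.2 *: to_lower x + to_lower x' :> lower A.
Proof.
apply: val_inj; rewrite /= !scalerDr !scalerA tS1_tri.
by rewrite -tSS mulr1.
Qed.
Lemma to_lower_upper (x : upper A) : to_lower (val x) = 0.
Proof. by apply: val_inj; rewrite /= -cornerP scalerA tSR scale0r. Qed.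
Lemma to_upper_lower (y : lower A) : to_upper (val y) = 0.
Proof. by apply: val_inj; rewrite /= -cornerP scalerA tRS scale0r. Qed.
Lemma scale_upper a (x : upper A) : a *: val x = val (a.1.1 *: x).
Proof. by rewrite -{1}(cornerP x) scalerA tri_tR1. Qed.
Lemma scale_lower a (y : lower A) : a *: val y = val (mact a.1.2 y) + val (a.2 *: y).
Proof. by rewrite -{1}(cornerP y) scalerA tri_tS1 scalerDl. Qed.
End OneModule.

Lemma upper_map_mact A B (f : {linear A -> B}) m y :
  upper_map f (mact m y) = mact m (lower_map f y).
Proof. by apply: val_inj; rewrite /= linearZ. Qed.

Section Triples.
Implicit Types t : triple M.

Lemma tri_fst_lin t a (v w : tri_mod t) :
  (a *: v + w).1 = a.1.1 *: v.1 + tri_phi t (tens a.1.2 v.2) + w.1.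
Proof. by []. Qed.
Lemma tri_snd_lin t a (v w : tri_mod t) : (a *: v + w).2 = a.2 *: v.2 + w.2.
Proof. by []. Qed.

Lemma tri_into E t (g1 : {linear upper E -> tri_fst t}) (g2 : {linear lower E -> tri_snd t}) :
  (forall m y, g1 (mact m y) = tri_phi t (tens m (g2 y))) ->
  exists F : {linear E -> tri_mod t}, forall x, F x = (g1 (to_upper x), g2 (to_lower x)).
Proof.
move=> g12; have [|F FE] := @linear_of_fun Lam E (tri_mod t)
  (fun x => (g1 (to_upper x), g2 (to_lower x))).
  move=> a x y; rewrite to_upper_lin to_lower_lin linearP !linearD linearZ /= g12.
  by congr (_, _).
by exists F.
Qed.

Lemma tri_out E t (g1 : {linear tri_fst t -> upper E}) (g2 : {linear tri_snd t -> lower E}) :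
  (forall m y, g1 (tri_phi t (tens m y)) = mact m (g2 y)) ->
  exists F : {linear tri_mod t -> E}, forall v, F v = val (g1 v.1) + val (g2 v.2).
Proof.
move=> g12; have [|F FE] := @linear_of_fun Lam (tri_mod t) E
  (fun v => val (g1 v.1) + val (g2 v.2)).
  move=> a v w; rewrite scalerDr scale_upper scale_lower.
  rewrite tri_fst_lin tri_snd_lin.
  by rewrite !linearD !linearZ /= g12 [X in _ = X + _]addrA [RHS]addrACA.
by exists F.
Qed.

Lemma tri_map t t' (f1 : {linear tri_fst t -> tri_fst t'})
    (f2 : {linear tri_snd t -> tri_snd t'}) :
  (forall m y, f1 (tri_phi t (tens m y)) = tri_phi t' (tens m (f2 y))) ->
  exists F : {linear tri_mod t -> tri_mod t'}, forall v, F v = (f1 v.1, f2 v.2).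
Proof.
move=> f12; have [|F FE] := @linear_of_fun Lam (tri_mod t) (tri_mod t')
  (fun v => (f1 v.1, f2 v.2)).
  by move=> a v w; congr (_, _); rewrite /= !linearD !linearZ /= ?f12.
by exists F.
Qed.

Lemma tri_map_short_exact t1 t2 t3 (f1 : {linear tri_fst t1 -> tri_fst t2})
    (f2 : {linear tri_snd t1 -> tri_snd t2}) (F : {linear tri_mod t1 -> tri_mod t2})
    (g1 : {linear tri_fst t2 -> tri_fst t3}) (g2 : {linear tri_snd t2 -> tri_snd t3})
    (G : {linear tri_mod t2 -> tri_mod t3}) :
  (forall v, F v = (f1 v.1, f2 v.2)) -> (forall v, G v = (g1 v.1, g2 v.2)) ->
  short_exact f1 g1 -> short_exact f2 g2 -> short_exact F G.
Proof.
move=> FE GE [f1i ex1 g1s] [f2i ex2 g2s]; split.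
- by move=> [x y] [x' y']; rewrite !FE => -[/f1i <- /f2i <-].
- move=> [x y]; rewrite GE; split=> [[/ex1[x' <-] /ex2[y' <-]]|[[x' y']]].
    by exists (x', y'); rewrite FE.
  by rewrite FE => -[<- <-] /=; rewrite (exact_comp0 ex1) (exact_comp0 ex2).
- by move=> [x y]; have [x' <-] := g1s x; have [y' <-] := g2s y; exists (x', y'); rewrite GE.
Qed.

Lemma tri_ses t1 t2 t3 (f1 : {linear tri_fst t1 -> tri_fst t2})
    (f2 : {linear tri_snd t1 -> tri_snd t2})
    (g1 : {linear tri_fst t2 -> tri_fst t3}) (g2 : {linear tri_snd t2 -> tri_snd t3}) :
  short_exact f1 g1 -> short_exact f2 g2 ->
  (forall m y, f1 (tri_phi t1 (tens m y)) = tri_phi t2 (tens m (f2 y))) ->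
  (forall m y, g1 (tri_phi t2 (tens m y)) = tri_phi t3 (tens m (g2 y))) ->
  exists (F : {linear tri_mod t1 -> tri_mod t2}) (G : {linear tri_mod t2 -> tri_mod t3}),
    short_exact F G.
Proof.
move=> e1 e2 /tri_map[F FE] /tri_map[G GE]; exists F, G.
exact: tri_map_short_exact FE GE e1 e2.
Qed.

Lemma upper_tri t :
  exists (u : {linear upper (tri_mod t) -> tri_fst t})
    (v : {linear tri_fst t -> upper (tri_mod t)}),
  [/\ cancel u v, cancel v u, forall x, u x = (val x).1 & forall x, val (v x) = (x, 0)].
Proof.
have [|u uE] := @linear_of_fun R (upper (tri_mod t)) (tri_fst t) (fun x => (val x).1).
  move=> a x y.
  by rewrite [LHS](tri_fst_lin (tR a) (val x) (val y)) tens0l linear0 addr0.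
have upper_snd0 (x : upper (tri_mod t)) : (val x).2 = 0 by rewrite -cornerP; apply: scale0r.
have xP (x : tri_fst t) : ((x, 0) : tri_mod t) \in
    @corner_pred _ _ (upper_embedding M) (tri_mod t).
  rewrite unfold_in; apply/eqP; congr (_, _); rewrite /= ?scaler0 //.
  by rewrite scale1r tens0l linear0 addr0.
have uK x : Corner (xP (u x)) = x.
  by apply: val_inj; rewrite uE /= -(upper_snd0 x); exact/esym/surjective_pairing.
have vK x : u (Corner (xP x)) = x by rewrite uE.
have [|v vE] := @linear_of_fun R _ (upper (tri_mod t)) (fun x => Corner (xP x)).
  move=> a x y; apply: (@can_inj _ _ u (fun x => Corner (xP x)) uK).
  by rewrite linearP !vK.
by exists u, v; split=> // x; rewrite vE ?uK ?vK.
Qed.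

Lemma lower_tri t :
  exists (u : {linear lower (tri_mod t) -> tri_snd t})
    (v : {linear tri_snd t -> lower (tri_mod t)}),
  [/\ cancel u v, cancel v u, forall x, u x = (val x).2 & forall x, val (v x) = (0, x)].
Proof.
have [|u uE] := @linear_of_fun S (lower (tri_mod t)) (tri_snd t) (fun x => (val x).2).
  by move=> a x y; exact: (tri_snd_lin (tS a) (val x) (val y)).
have lower_fst0 (x : lower (tri_mod t)) : (val x).1 = 0.
  by rewrite -cornerP /= scale0r tens0l linear0 addr0.
have xP (x : tri_snd t) : ((0, x) : tri_mod t) \in
    @corner_pred _ _ (lower_embedding M) (tri_mod t).
  rewrite unfold_in; apply/eqP; congr (_, _); rewrite /= ?scale1r //.
  by rewrite scaler0 tens0l linear0 addr0.
have uK x : Corner (xP (u x)) = x.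
  by apply: val_inj; rewrite uE /= -(lower_fst0 x); exact/esym/surjective_pairing.
have vK x : u (Corner (xP x)) = x by rewrite uE.
have [|v vE] := @linear_of_fun S _ (lower (tri_mod t)) (fun x => Corner (xP x)).
  move=> a x y; apply: (@can_inj _ _ u (fun x => Corner (xP x)) uK).
  by rewrite linearP !vK.
by exists u, v; split=> // x; rewrite vE ?uK ?vK.
Qed.

Lemma upper_tri_iso t : iso_mod (upper (tri_mod t)) (tri_fst t).
Proof. by have [u [v [uK vK _ _]]] := upper_tri t; exists u; exists v. Qed.
Lemma lower_tri_iso t : iso_mod (lower (tri_mod t)) (tri_snd t).
Proof. by have [u [v [uK vK _ _]]] := lower_tri t; exists u; exists v. Qed.

Lemma triple_of A : exists t, iso_mod (tri_mod t) A.
Proof.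
have [||phi phiE] := @tensor_lift_linear _ _ M (lower A) (upper A) (@mact A).
- by split; [exact: mactDl | exact: mactDr | exact: mactZr].
- exact: mactZl.
pose t := Triple phi; exists t; apply: iso_sym.
have [|F FE] := @tri_into A t (idfun : {linear upper A -> upper A})
  (idfun : {linear lower A -> lower A}).
  by move=> m y; rewrite /= phiE.
exists F; exists (fun v => val v.1 + val v.2) => [x|[x y]]; first by rewrite FE -upper_lowerE.
by rewrite FE /= !to_cornerD !to_corner_val to_upper_lower to_lower_upper addr0 add0r.
Qed.

(** Membership no longer refers to a representing triple, which is what makes
    the class accessible for kernels, projectives and summands. *)
Lemma comp_classP (cP : mod_class R) (cQ : mod_class S) A :
  admissible cP -> admissible cQ -> comp_class M cP cQ A <-> cP (upper A) /\ cQ (lower A).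
Proof.
move=> [_ admP] [_ admQ]; split=> [[t [[Pt Qt] tA]]|[PA QA]].
  split.
    apply: admP Pt; apply: iso_trans (iso_sym (upper_tri_iso t)) _.
    exact: corner_iso tA.
  apply: admQ Qt; apply: iso_trans (iso_sym (lower_tri_iso t)) _.
  exact: corner_iso tA.
have [t tA] := triple_of A; exists t; split=> //; split.
  exact: admP (iso_trans (corner_iso (upper_embedding M) (iso_sym tA)) (upper_tri_iso t)) PA.
exact: admQ (iso_trans (corner_iso (lower_embedding M) (iso_sym tA)) (lower_tri_iso t)) QA.
Qed.

Lemma comp_class_summands (cP : mod_class R) (cQ : mod_class S) :
  admissible cP -> admissible cQ -> closed_summands cP -> closed_summands cQ ->
  closed_summands (comp_class M cP cQ).
Proof.
move=> aP aQ sP sQ A B C AB; rewrite !comp_classP // => -[PC QC].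
split; first exact: sP (iso_trans (corner_prod _ A B) (corner_iso _ AB)) PC.
exact: sQ (iso_trans (corner_prod _ A B) (corner_iso _ AB)) QC.
Qed.
End Triples.
End Components.

(** * Coinduced modules and the first adjunctions *)

Section HomFunctor.
Context {R S : pzRingType} (M : bimodType R S).
Local Notation upper := (corner (upper_embedding M)).
Local Notation lower := (corner (lower_embedding M)).
Local Notation to_upper := (to_corner (upper_embedding M)).
Local Notation to_lower := (to_corner (lower_embedding M)).
Local Notation upper_map := (@corner_map _ _ (upper_embedding M) _ _).
Local Notation lower_map := (@corner_map _ _ (lower_embedding M) _ _).
Implicit Types (X Z U : lmodType R) (Y N V : lmodType S).

Lemma hom_of_fun Y X (h : Y -> M -> X) :
  (forall y, linear (h y)) ->
  (forall s y y' m, h (s *: y + y') m = h y (m ·r s) + h y' m) ->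
  exists H : {linear Y -> hom M X}, forall y m, H y m = h y m.
Proof.
move=> hl hD; have /choice[k kE] y := linear_of_fun (hl y).
have [|H HE] := @linear_of_fun _ Y (hom M X) (k : Y -> hom M X).
  by move=> s y y'; apply: homP => m; rewrite kE hD -!kE.
by exists H => y m; rewrite HE kE.
Qed.

Lemma phi_of_hom Y X (h : {linear Y -> hom M X}) :
  exists phi : {linear tensor M Y -> X}, forall m y, phi (tens m y) = h y m.
Proof.
apply: tensor_lift_linear; last by move=> r m y; rewrite linearZ.
split=> [m m' y|m y y'|m s y]; first exact: linearD.
  by rewrite linearD.
by rewrite linearZ.
Qed.

Definition coind_phi X : {linear tensor M (hom M X) -> X} :=
  projT1 (cid (phi_of_hom (idfun : {linear hom M X -> hom M X}))).
(** The triple (X, Hom(M, X)) with evaluation as structure map, right adjoint to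
    the upper component ([into_coind]). *)
Definition coind X : triple M := Triple (coind_phi X).
Lemma coindE X m (h : hom M X) : tri_phi (coind X) (tens m h) = h m.
Proof. exact: projT2 (cid (phi_of_hom (idfun : {linear hom M X -> hom M X}))) m h. Qed.

(** (0, N), right adjoint to the lower component. *)
Definition lower_triple N : triple M := Triple (\0%R : {linear tensor M N -> zero_mod}).

Definition hom_map X X' (f : {linear X -> X'}) (h : hom M X) : hom M X' :=
  f \o h : {linear M -> X'}.
Fact hom_map_linear X X' (f : {linear X -> X'}) : linear (hom_map f).
Proof. by move=> s h h'; apply: homP => m; rewrite /= linearD. Qed.
HB.instance Definition _ X X' (f : {linear X -> X'}) :=
  GRing.isLinear.Build S (hom M X) (hom M X') *:%R (hom_map f) (hom_map_linear f).

Lemma hom_short_exact Z X U (a : {linear Z -> X}) (p : {linear X -> U}) :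
  short_exact a p -> Ext1 M Z ->
  short_exact (hom_map a : {linear hom M Z -> hom M X}) (hom_map p).
Proof.
move=> ap e; have [ai ex ps] := ap; split.
- move=> h h' hh; apply: homP => m; apply: ai.
  exact: (congr1 (fun k : hom M X => k m) hh).
- move=> h; split=> [ph|[h' <-]].
    have [|h' h'E] := @lift_mono _ _ _ _ a (h : {linear M -> X}) ai.
      by move=> m; apply/ex; exact: (congr1 (fun k : hom M U => k m) ph).
    by exists h'; apply: homP => m; exact: h'E.
  by apply: homP => m; exact: (exact_comp0 ex).
- move=> h; have [h' h'E] := Ext1_lift (h : {linear M -> U}) e ap.
  by exists h'; apply: homP => m; exact: h'E.
Qed.

Section Into.
Context (E : lmodType (triring M)).

Lemma into_coind X (g : {linear upper E -> X}) :
  exists F : {linear E -> tri_mod (coind X)},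
    (forall x, (F x).1 = g (to_upper x)) /\ (forall x m, (F x).2 m = g (mact m (to_lower x))).
Proof.
have [||h hE] := @hom_of_fun (lower E) X (fun y m => g (mact m y)).
- by move=> y r m m'; rewrite mactDl mactZl linearP.
- by move=> s y y' m; rewrite mactDr mactZr linearD.
have [|F FE] := @tri_into _ _ _ E (coind X) g h.
  by move=> m y; rewrite coindE hE.
by exists F; split=> x; rewrite FE //= => m; rewrite hE.
Qed.

Lemma into_lower_triple N (g : {linear lower E -> N}) :
  exists F : {linear E -> tri_mod (lower_triple N)}, forall x, (F x).2 = g (to_lower x).
Proof.
have [//|F FE] := @tri_into _ _ _ E (lower_triple N) \0%R g.
by exists F => x; rewrite FE.
Qed.

Lemma out_fst t (F : {linear E -> tri_mod t}) :
  exists f : {linear upper E -> tri_fst t}, forall x, f x = (F (val x)).1.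
Proof.
have [u [_ [_ _ uE _]]] := upper_tri t; exists (u \o upper_map F : {linear _ -> _}) => x.
by rewrite /= uE.
Qed.
Lemma out_snd t (F : {linear E -> tri_mod t}) :
  exists f : {linear lower E -> tri_snd t}, forall x, f x = (F (val x)).2.
Proof.
have [u [_ [_ _ uE _]]] := lower_tri t; exists (u \o lower_map F : {linear _ -> _}) => x.
by rewrite /= uE.
Qed.
Lemma fst_to_upper t (F : {linear E -> tri_mod t}) x : (F (val (to_upper x))).1 = (F x).1.
Proof. by rewrite /= linearZ /= scale1r tens0l linear0 addr0. Qed.
Lemma snd_to_lower t (F : {linear E -> tri_mod t}) x : (F (val (to_lower x))).2 = (F x).2.
Proof. by rewrite /= linearZ /= scale1r. Qed.
Lemma fst_mact t (F : {linear E -> tri_mod t}) m x :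
  (F (val (mact m (to_lower x)))).1 = tri_phi t (tens m (F x).2).
Proof. by rewrite /= !linearZ /= scale0r add0r scale1r. Qed.
End Into.

Lemma coind_ext X (v w : tri_mod (coind X)) :
  v.1 = w.1 -> (forall m, (v.2 : hom M X) m = (w.2 : hom M X) m) -> v = w.
Proof. by case: v w => [x h] [x' h'] /= -> /homP ->. Qed.
Lemma lower_triple_ext N (v w : tri_mod (lower_triple N)) : v.2 = w.2 -> v = w.
Proof. by case: v w => [x y] [x' y'] /= ->; rewrite (zero_modP x) (zero_modP x'). Qed.

Lemma Ext1_lower_triple C N : Ext1 (lower C) N -> Ext1 C (tri_mod (lower_triple N)).
Proof.
move=> e K E i p ip f; have [f2 f2E] := out_snd f.
have [g gE] := e _ _ _ _ (corner_short_exact (lower_embedding M) ip) f2.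
have [F FE] := into_lower_triple g; exists F => x; apply: lower_triple_ext.
by rewrite FE to_corner_map gE f2E snd_to_lower.
Qed.

(** By adjunction, maps into [coind X] extend as soon as their upper components
    do. *)
Lemma Ext1_coind C X : Ext1 (upper C) X -> Ext1 C (tri_mod (coind X)).
Proof.
move=> e K E i p ip f; have [f1 f1E] := out_fst f.
have [g gE] := e _ _ _ _ (corner_short_exact (upper_embedding M) ip) f1.
have [F [F1 F2]] := into_coind g; exists F => x; apply: coind_ext => [|m].
  by rewrite F1 to_corner_map gE f1E fst_to_upper.
by rewrite F2 to_corner_map -upper_map_mact gE f1E fst_mact coindE.
Qed.

Lemma lower_triple_ses N1 N N2 (f : {linear N1 -> N}) (g : {linear N -> N2}) :
  short_exact f g ->
  exists (F : {linear tri_mod (lower_triple N1) -> tri_mod (lower_triple N)})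
    (G : {linear tri_mod (lower_triple N) -> tri_mod (lower_triple N2)}), short_exact F G.
Proof.
move=> fg; have id0 := short_exact_0id (zero_mod : lmodType R) (zero_modP (T := R)).
by apply: (@tri_ses _ _ _ (lower_triple N1) (lower_triple N) (lower_triple N2)) id0 fg _ _.
Qed.

Lemma coind_ses Z X U (a : {linear Z -> X}) (p : {linear X -> U}) :
  short_exact a p -> Ext1 M Z ->
  exists (F : {linear tri_mod (coind Z) -> tri_mod (coind X)})
    (G : {linear tri_mod (coind X) -> tri_mod (coind U)}), short_exact F G.
Proof.
move=> ap e; apply: (@tri_ses _ _ _ (coind Z) (coind X) (coind U) _ _ _ _
  ap (hom_short_exact ap e)) => m h; by rewrite !coindE.
Qed.

Lemma projective_lower (P : lmodType (triring M)) : projective P -> projective (lower P).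
Proof.
move=> Pp A B g f gs; have [F FE] := into_lower_triple f.
have [|G GE] := @tri_map _ _ _ (lower_triple A) (lower_triple B) \0%R g.
  by move=> m y; rewrite /=.
have Gs : surjective_map G.
  move=> [z y]; have [x xE] := gs y; exists (0, x).
  by apply: lower_triple_ext; rewrite GE.
have [H HE] := Pp _ _ G F Gs; have [h hE] := out_snd H; exists h => x.
by have := congr1 snd (HE (val x)); rewrite GE FE /= hE to_corner_val.
Qed.

(** The upper component of a projective P need not be projective, but by
    adjunction it lifts against p when (X, Hom(M, X)) -> (U, Hom(M, U)) is onto. *)
Lemma upper_projective_lift (P : lmodType (triring M)) Z X U
    (a : {linear Z -> X}) (p : {linear X -> U}) (f : {linear upper P -> U}) :
  projective P -> short_exact a p -> Ext1 M Z ->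
  exists g : {linear upper P -> X}, forall x, p (g x) = f x.
Proof.
move=> Pp ap e; have [F [F1 _]] := into_coind f.
have [|G GE] := @tri_map _ _ _ (coind X) (coind U) p (hom_map p).
  by move=> m y; rewrite !coindE.
have Gs : surjective_map G.
  have [_ _ ps] := ap; have [_ _ hs] := hom_short_exact ap e.
  by move=> [z y]; have [x <-] := ps z; have [h <-] := hs y; exists (x, h); rewrite GE.
have [H HE] := Pp _ _ G F Gs; have [h hE] := out_fst H; exists h => x.
by have := congr1 fst (HE (val x)); rewrite GE F1 /= hE to_corner_val.
Qed.

Section Classes.
Context (cM : mod_class R) (cN : mod_class S) (admM : admissible cM) (admN : admissible cN).

Lemma tri_adjE t y m : (@tri_adj R S M t y) m = tri_phi t (tens m y).
Proof. by []. Qed.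

Lemma frakD_coind X : cM X -> frakD M cM cN (tri_mod (coind X)).
Proof.
move=> MX; exists (coind X); split; last exact: iso_refl.
have adjE h : tri_adj (t := coind X) h = h by apply: homP => m; exact: coindE.
split=> //.
- apply: admN.1 => x; apply: val_inj.
  by have := valP x; rewrite unfold_in => /eqP /=; rewrite adjE.
- move=> x; rewrite -[x]quotmod_reprK; apply/quotmod_pi0/asboolP.
  by exists (quotmod_repr x); rewrite /= adjE.
Qed.

Lemma frakD_lower_triple N : cN N -> frakD M cM cN (tri_mod (lower_triple N)).
Proof.
move=> NN; exists (lower_triple N); split; last exact: iso_refl.
have hom0 (h : hom M zero_mod) : h = 0 by apply: homP => m; exact: zero_modP.
split.
- exact: admM.1 zero_modP.
- apply: admN.2 NN.
  have [|f fE] := @linear_of_fun _ (kernel (@tri_adj _ _ _ (lower_triple N))) N val.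
    by move=> a x y; rewrite linearP.
  apply: iso_sym; apply: (bij_iso (f := f)) => [x y|y].
    by rewrite !fE => /val_inj.
  have yk : y \in ker_pred (@tri_adj _ _ _ (lower_triple N)).
    by rewrite unfold_in; apply/eqP; exact: hom0.
  by exists (Sub y yk : kernel _); rewrite fE SubK.
- move=> x; rewrite -[x]quotmod_reprK; apply/quotmod_pi0/asboolP.
  by exists 0; rewrite linear0 [RHS]hom0.
Qed.

(** The sequence 0 -> (0, Ker phi^M) -> D -> (Z, Hom(M, Z)) -> 0. *)
Lemma frakD_ses D : frakD M cM cN D -> exists N X
    (F : {linear tri_mod (lower_triple N) -> D}) (G : {linear D -> tri_mod (coind X)}),
  [/\ cN N, cM X & short_exact F G].
Proof.
move=> [t [[MZ NK coker0] tD]].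
have adjs : surjective_map (@tri_adj _ _ _ t).
  move=> h; have /quotmod_pi0/asboolP[y <-] := coker0 (quotmod_pi _ h).
  by exists y.
have [k ke] := kernel_short_exact adjs.
have [||F [G FG]] := @tri_ses _ _ _ (lower_triple (kernel (@tri_adj _ _ _ t))) t
  (coind (tri_fst t)) \0%R k (idfun : {linear tri_fst t -> tri_fst t}) (@tri_adj _ _ _ t)
  (short_exact_id0 _ zero_modP) ke.
- move=> m y; have [_ ex _] := ke; apply/esym.
  exact: (congr1 (fun h : hom M (tri_fst t) => h m) (exact_comp0 ex y)).
- by move=> m y; rewrite coindE.
have [F' [G' FG']] := short_exact_iso2 FG tD.
by exists _, _, F', G'.
Qed.

Lemma wedge_lower_triple m N :
  wedge cN m N -> wedge (frakD M cM cN) m (tri_mod (lower_triple N)).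
Proof.
elim: m N => [|m IH] N wN.
  by apply: wedge_of_class; apply: frakD_lower_triple; exact: wedge_class0 wN.
have [K [C [f [g [fg NC wK]]]]] := wedge_inv admN wN.
by have [F [G FG]] := lower_triple_ses fg; exact: wedge_step FG (frakD_lower_triple NC) (IH _ wK).
Qed.

(** Each step of the resolution costs one degree of vanishing. *)
Lemma Ext_vanishes_wedge n m X :
  (forall j (Z : lmodType R), (1 <= j <= n)%N -> cM Z -> Ext_vanishes j M Z) ->
  wedge cM m X -> forall j, (j.+1 + m <= n)%N -> Ext_vanishes j.+1 M X.
Proof.
move=> v; elim: m X => [|m IH] X wX j jn.
  by apply: v (wedge_class0 admM wX); rewrite -[j.+1]addn0.
have [K [C [f [g [fg MC wK]]]]] := wedge_inv admM wX.
apply: (Ext_vanishes_cokernel fg).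
  by apply: v MC; rewrite /= (leq_trans _ jn) ?leq_addr.
by apply: IH wK _ _; rewrite addSnnS.
Qed.

(** Hom(M, -) stays exact on a resolution of length m < n, as the successive
    syzygies keep a vanishing Ext^1(M, -). *)
Lemma wedge_coind n m X :
  (forall j (Z : lmodType R), (1 <= j <= n)%N -> cM Z -> Ext_vanishes j M Z) ->
  (m < n)%N -> wedge cM m X -> wedge (frakD M cM cN) m (tri_mod (coind X)).
Proof.
move=> v; elim: m X => [|m IH] X mn wX.
  by apply: wedge_of_class; apply: frakD_coind; exact: wedge_class0 wX.
have [K [C [f [g [fg MC wK]]]]] := wedge_inv admM wX.
have eK : Ext1 M K.
  apply: Ext1_of_Ext_vanishes; apply: Ext_vanishes_wedge v wK _ _.
  by rewrite add1n ltnW.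
have [F [G FG]] := coind_ses fg eK.
by apply: wedge_step FG (frakD_coind MC) (IH _ _ wK); exact: ltnW.
Qed.
End Classes.
End HomFunctor.

(** * The left cotorsion pair *)

Section Part1.
Context {R S : pzRingType} (M : bimodType R S) (n : nat) (n_ge1 : (1 <= n)%N).
Local Notation upper := (corner (upper_embedding M)).
Local Notation lower := (corner (lower_embedding M)).
Local Notation to_upper := (to_corner (upper_embedding M)).
Local Notation to_lower := (to_corner (lower_embedding M)).
Local Notation upper_map := (@corner_map _ _ (upper_embedding M) _ _).
Local Notation lower_map := (@corner_map _ _ (lower_embedding M) _ _).
Context (cX cM : mod_class R) (cY cN : mod_class S).
Context (admX : admissible cX) (admM : admissible cM)
    (admY : admissible cY) (admN : admissible cN).
Context (cotR : left_cotorsion_pair n cX cM) (cotS : left_cotorsion_pair n cY cN).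
Context (extM : forall j (Z : lmodType R), (1 <= j <= n)%N -> cM Z -> Ext_vanishes j M Z).

Lemma Ext1_wedgeM Z : wedge cM n.-1 Z -> Ext1 M Z.
Proof.
move=> wZ; apply: Ext1_of_Ext_vanishes; apply: (Ext_vanishes_wedge admM extM wZ).
by rewrite add1n prednK.
Qed.

(** For the upper component, the cX-approximation of [upper P] splits because
    its kernel K has Ext^1(M, K) = 0. *)
Lemma comp_class_projective P : projective P -> comp_class M cX cY P.
Proof.
move=> Pp; apply/comp_classP => //; split; last first.
  exact: left_cotorsion_projective cotS (projective_lower Pp).
have [summ _ app] := cotR; have [K [C [f [g [fg CC wK]]]]] := app (upper P).
have [Q PQ] : exists Q : lmodType R, iso_mod (upper P * Q)%type C.
  apply: (split_summand fg).
  have [s sE] := upper_projective_lift (idfun : {linear upper P -> upper P}) Pp fg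
    (Ext1_wedgeM wK).
  by exists s.
exact: summ PQ CC.
Qed.

Lemma Ext1_comp_frakD C D : comp_class M cX cY C -> frakD M cM cN D -> Ext1 C D.
Proof.
move=> /comp_classP[] // XC YC /frakD_ses[N [X [F [G [NN MX FG]]]]].
have [_ orthR _] := cotR; have [_ orthS _] := cotS.
apply: (Ext1_ext_r FG).
  by apply: Ext1_lower_triple; apply: Ext1_of_Ext_vanishes; apply: orthS YC NN.
by apply: Ext1_coind; apply: Ext1_of_Ext_vanishes; apply: orthR XC MX.
Qed.

(** Two steps: the pullback V of the lower component makes (X, V) -> A onto with
    kernel (Z, Hom(M, Z)), and then the lower component V is approximated alone. *)
Lemma comp_approximation (A : lmodType (triring M)) :
  closed_extensions (wedge (frakD M cM cN) n.-1) ->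
  exists (K C : lmodType (triring M)) (f : {linear K -> C}) (g : {linear C -> A}),
    [/\ short_exact f g, comp_class M cX cY C & wedge (frakD M cM cN) n.-1 K].
Proof.
move=> extD; have [t tA] := triple_of A.
have [_ _ /(_ (tri_fst t))[Z [X [a [p [ap XX wZ]]]]]] := cotR.
have homap := hom_short_exact ap (Ext1_wedgeM wZ).
have [V [i [q [u [iq ui sq _ _]]]]] := pullback_ses (@tri_adj _ _ _ t) homap.
have [_ _ /(_ V)[N [Y [b [r [br YY wN]]]]]] := cotS.
have [phi phiE] := phi_of_hom u; have [psi psiE] := phi_of_hom (u \o r : {linear _ -> _}).
pose t1 := Triple phi; pose t2 := Triple psi.
have [||F1 [G1 FG1]] := @tri_ses _ _ _ (coind M Z) t1 t a i p q ap iq.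
- by move=> m h; rewrite coindE /= phiE ui.
- move=> m v /=; rewrite phiE -(tri_adjE (t := t)) -sq //.
have [||F2 [G2 FG2]] := @tri_ses _ _ _ (lower_triple M N) t2 t1 \0%R b idfun r
   (short_exact_id0 _ zero_modP) br.
- by move=> m y /=; rewrite psiE /=; have [_ ex _] := br; rewrite (exact_comp0 ex) linear0.
- by move=> m y /=; rewrite psiE phiE.
have [K [k [c [d [kg cd _]]]]] := short_exact_epi_comp FG2 FG1.
have [g kg'] := short_exact_iso3 kg tA.
exists K, (tri_mod t2), k, g; split=> //; first by exists t2; split=> //; exact: iso_refl.
apply: extD cd _ _; first exact: wedge_lower_triple.
by apply: wedge_coind extM _ wZ => //; rewrite prednK.
Qed.

Lemma comp_frakD_left_cotorsion : resolving (comp_class M cX cY) ->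
  closed_extensions (wedge (frakD M cM cN) n.-1) ->
  left_cotorsion_pair n (comp_class M cX cY) (frakD M cM cN) /\
  hereditary n (comp_class M cX cY) (frakD M cM cN).
Proof.
move=> [_ ker] extD.
have ext i C D : comp_class M cX cY C -> frakD M cM cN D -> Ext_vanishes i.+1 C D.
  move=> CC DD; apply: Ext_vanishes_of_resolving ker comp_class_projective _ _ _ CC.
  by move=> C'; move/Ext1_comp_frakD; apply.
split; last by move=> C D; exact: ext.
split; last by move=> A; exact: comp_approximation.
- have [sX _ _] := cotR; have [sY _ _] := cotS; exact: comp_class_summands.
- by move=> [|i] C D // _; exact: ext.
Qed.
End Part1.

(** * Induced modules and the dual adjunctions *)

Section TensorFunctor.
Context {R S : pzRingType} (M : bimodType R S).
Local Notation upper := (corner (upper_embedding M)).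
Local Notation lower := (corner (lower_embedding M)).
Local Notation to_upper := (to_corner (upper_embedding M)).
Local Notation to_lower := (to_corner (lower_embedding M)).
Local Notation upper_map := (@corner_map _ _ (upper_embedding M) _ _).
Local Notation lower_map := (@corner_map _ _ (lower_embedding M) _ _).
Implicit Types (X Z U : lmodType R) (Y N V : lmodType S) (D : lmodType (triring M)).

(** (X, 0), left adjoint to the upper component. *)
Definition upper_triple X : triple M := Triple (\0%R : {linear tensor M zero_mod -> X}).
(** (M (x) Y, Y) with the identity as structure map, left adjoint to the lower
    component. *)
Definition ind Y : triple M := Triple (idfun : {linear tensor M Y -> tensor M Y}).

Lemma Ext1_upper_triple X D : Ext1 X (upper D) -> Ext1 (tri_mod (upper_triple X)) D.
Proof.
move=> e; apply: Ext1_of_split => E i p ip.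
have [_ [h [_ _ _ hE]]] := upper_tri (upper_triple X).
have [s sE] := Ext1_lift h e (corner_short_exact (upper_embedding M) ip).
have [|F FE] := @tri_out _ _ _ E (upper_triple X) s \0%R.
  by move=> m y; rewrite mact0 [LHS]linear0.
exists F => -[x y]; rewrite FE addr0.
by have /(congr1 val) := sE x; rewrite hE (zero_modP y) /= => ->.
Qed.

(** A section of the lower components determines, by adjunction, a map from
    [ind Y]; that it is a section is checked on generators m (x) y. *)
Lemma Ext1_ind Y D : Ext1 Y (lower D) -> Ext1 (tri_mod (ind Y)) D.
Proof.
move=> e; apply: Ext1_of_split => E i p ip.
have [_ [h1 [_ _ _ h1E]]] := upper_tri (ind Y).
have [_ [h2 [_ _ _ h2E]]] := lower_tri (ind Y).
have [s sE] := Ext1_lift h2 e (corner_short_exact (lower_embedding M) ip).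
have [||g gE] := @tensor_lift_linear _ _ M Y (upper E) (fun m y => mact m (s y)).
- split=> [m m' y|m y y'|m t y]; first exact: mactDl.
    by rewrite linearD mactDr.
  by rewrite linearZ mactZr.
- by move=> r m y; exact: mactZl.
have pg t : upper_map p (g t) = h1 t.
  apply: (tensor_linear_ext (f := upper_map p \o g : {linear _ -> _})) => m y /=.
  rewrite gE upper_map_mact [lower_map p _]sE; apply: val_inj; rewrite h1E /= h2E.
  by congr (_, _); rewrite /= ?scale0r ?add0r.
have [|F FE] := @tri_out _ _ _ E (ind Y) g s; first by move=> m y; rewrite -gE.
exists F => -[t y]; rewrite FE linearD /=.
have /(congr1 val) /= -> := pg t; have /(congr1 val) /= -> := sE y.
by rewrite h1E h2E; congr (_, _); rewrite /= ?addr0 ?add0r.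
Qed.

Lemma upper_triple_ses X1 X X2 (f : {linear X1 -> X}) (g : {linear X -> X2}) :
  short_exact f g ->
  exists (F : {linear tri_mod (upper_triple X1) -> tri_mod (upper_triple X)})
    (G : {linear tri_mod (upper_triple X) -> tri_mod (upper_triple X2)}), short_exact F G.
Proof.
move=> fg; have id0 := short_exact_0id (zero_mod : lmodType S) (zero_modP (T := S)).
by apply: (@tri_ses _ _ _ (upper_triple X1) (upper_triple X) (upper_triple X2)) fg id0 _ _
  => m y; exact: linear0.
Qed.

Lemma ind_ses Y1 Y Y2 (f : {linear Y1 -> Y}) (g : {linear Y -> Y2}) :
  short_exact f g -> Tor_zero M 0 Y2 ->
  exists (F : {linear tri_mod (ind Y1) -> tri_mod (ind Y)})
    (G : {linear tri_mod (ind Y) -> tri_mod (ind Y2)}), short_exact F G.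
Proof.
move=> fg t2; apply: (@tri_ses _ _ _ (ind Y1) (ind Y) (ind Y2) _ _ _ _
  (tensor_short_exact fg t2) fg) => m y; exact: tensor_map_tens.
Qed.

Lemma tensor_zero Y : is_zero_mod Y -> is_zero_mod (tensor M Y).
Proof.
move=> Y0 t; apply: (tensor_linear_ext (f := idfun) (g := \0%R : {linear _ -> _})) => m y /=.
by rewrite (Y0 y); apply: (addrI (tens m (0 : Y))); rewrite -tensDr !addr0.
Qed.

Section Classes.
Context (cX : mod_class R) (cY : mod_class S) (admX : admissible cX) (admY : admissible cY).

Lemma frakB_ind Y : cY Y -> frakB M cX cY (tri_mod (ind Y)).
Proof.
move=> YY; exists (ind Y); split; last exact: iso_refl.
split=> //.
  by move=> x; apply: val_inj; have := valP x; rewrite unfold_in => /eqP.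
apply: admX.1 => x; rewrite -[x]quotmod_reprK; apply/quotmod_pi0/asboolP.
by exists (quotmod_repr x).
Qed.

Lemma frakB_upper_triple X : cX X -> frakB M cX cY (tri_mod (upper_triple X)).
Proof.
move=> XX; exists (upper_triple X); split; last exact: iso_refl.
have T0 : is_zero_mod (tensor M (zero_mod : lmodType S)) := tensor_zero zero_modP.
split.
- exact: admY.1 zero_modP.
- by move=> x; apply: val_inj; exact: T0.
- apply: admX.2 XX; have [p pe] := @cokernel_short_exact _ _ _ (tri_phi (upper_triple X))
    (fun x y _ => etrans (T0 x) (esym (T0 y))).
  exact: short_exact_cokernel_iso (short_exact_id0 X T0) pe.
Qed.

(** The sequence 0 -> (M (x) Y, Y) -> C -> (Coker phi, 0) -> 0. *)
Lemma frakB_ses C : frakB M cX cY C -> exists Y X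
    (F : {linear tri_mod (ind Y) -> C}) (G : {linear C -> tri_mod (upper_triple X)}),
  [/\ cY Y, cX X & short_exact F G].
Proof.
move=> [t [[YY ker0 XX] tC]].
have phii : injective_map (tri_phi t).
  apply: injective_map0 => x x0.
  have xk : x \in ker_pred (tri_phi t) by rewrite unfold_in x0.
  exact: (congr1 val (ker0 (Sub x xk : kernel (tri_phi t)))).
have [p pe] := cokernel_short_exact phii.
have [||F [G FG]] := @tri_ses _ _ _ (ind (tri_snd t)) t (upper_triple (cokernel (tri_phi t)))
  (tri_phi t) idfun p \0%R pe (short_exact_0id _ zero_modP) => //.
- by move=> m y; have [_ ex _] := pe; exact: (exact_comp0 ex).
have [F' [G' FG']] := short_exact_iso2 FG tC.
by exists _, _, F', G'.
Qed.

Lemma vee_upper_triple m X : vee cX m X -> vee (frakB M cX cY) m (tri_mod (upper_triple X)).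
Proof.
elim: m X => [|m IH] X wX.
  by apply: vee_of_class; apply: frakB_upper_triple; exact: vee_class0 wX.
have [C [K [f [g [fg XC wK]]]]] := vee_inv admX wX.
by have [F [G FG]] := upper_triple_ses fg; exact: vee_step FG (frakB_upper_triple XC) (IH _ wK).
Qed.

(** Each step of the coresolution costs one degree of vanishing. *)
Lemma Tor_zero_vee n m Y :
  (forall j (Y : lmodType S), (1 <= j <= n)%N -> cY Y -> Tor_vanishes j M Y) ->
  vee cY m Y -> forall j, (j + m < n)%N -> Tor_zero M j Y.
Proof.
move=> v; elim: m Y => [|m IH] Y wY j jn.
  by apply: Tor_zero_of_Tor_vanishes; apply: v (vee_class0 admY wY); rewrite -[j]addn0.
have [C [K [f [g [fg YC wK]]]]] := vee_inv admY wY.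
apply: (Tor_zero_shift M j).1 fg _ _; first by apply: IH wK _ _; rewrite addSnnS.
apply: Tor_zero_of_Tor_vanishes; apply: v YC.
by rewrite /= (leq_trans _ jn) // ltnS leq_addr.
Qed.

(** M (x) - stays exact on a coresolution of length m < n, as the successive
    cosyzygies keep a vanishing Tor_1(M, -). *)
Lemma vee_ind n m Y :
  (forall j (Y : lmodType S), (1 <= j <= n)%N -> cY Y -> Tor_vanishes j M Y) ->
  (m < n)%N -> vee cY m Y -> vee (frakB M cX cY) m (tri_mod (ind Y)).
Proof.
move=> v; elim: m Y => [|m IH] Y mn wY.
  by apply: vee_of_class; apply: frakB_ind; exact: vee_class0 wY.
have [C [K [f [g [fg YC wK]]]]] := vee_inv admY wY.
have [|F [G FG]] := ind_ses fg; first by apply: Tor_zero_vee v wK _ _; exact: ltnW.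
by apply: vee_step FG (frakB_ind YC) (IH _ _ wK); exact: ltnW.
Qed.
End Classes.
End TensorFunctor.

(** * The right cotorsion pair *)

Section Part2.
Context {R S : pzRingType} (M : bimodType R S) (n : nat) (n_ge1 : (1 <= n)%N).
Local Notation upper := (corner (upper_embedding M)).
Local Notation lower := (corner (lower_embedding M)).
Local Notation to_upper := (to_corner (upper_embedding M)).
Local Notation to_lower := (to_corner (lower_embedding M)).
Local Notation upper_map := (@corner_map _ _ (upper_embedding M) _ _).
Local Notation lower_map := (@corner_map _ _ (lower_embedding M) _ _).
Context (cX cM : mod_class R) (cY cN : mod_class S).
Context (admX : admissible cX) (admM : admissible cM)
    (admY : admissible cY) (admN : admissible cN).
Context (cotR : right_cotorsion_pair n cX cM) (cotS : right_cotorsion_pair n cY cN).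
Context (torM : forall j (Y : lmodType S), (1 <= j <= n)%N -> cY Y -> Tor_vanishes j M Y).

Lemma Ext1_frakB_comp C D : frakB M cX cY C -> comp_class M cM cN D -> Ext1 C D.
Proof.
move=> /frakB_ses[Y [X [F [G [YY XX FG]]]]] /comp_classP[] // MD ND.
have [_ orthR _] := cotR; have [_ orthS _] := cotS.
apply: (Ext1_ext_l FG).
  by apply: Ext1_ind; apply: Ext1_of_Ext_vanishes; apply: orthS YY ND.
by apply: Ext1_upper_triple; apply: Ext1_of_Ext_vanishes; apply: orthR XX MD.
Qed.

(** Two steps: pushing out the upper component makes A -> (U, N) injective with
    cokernel (M (x) Y, Y), and then the upper component U is coapproximated alone. *)
Lemma comp_coapproximation (A : lmodType (triring M)) :
  closed_extensions (vee (frakB M cX cY) n.-1) ->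
  exists (D K : lmodType (triring M)) (f : {linear A -> D}) (g : {linear D -> K}),
    [/\ short_exact f g, comp_class M cM cN D & vee (frakB M cX cY) n.-1 K].
Proof.
move=> extB; have [t tA] := triple_of A.
have [_ _ /(_ (tri_snd t))[N [Y [i [q [iq NN wY]]]]]] := cotS.
have tY : Tor_zero M 0 Y by apply: Tor_zero_vee torM wY _ _ => //; rewrite add0n prednK.
have [U [j [q' [u [jq uj qu _]]]]] := pushout_ses (tri_phi t) (tensor_short_exact iq tY).
have [_ _ /(_ U)[Z [X [a [p [ap MZ wX]]]]]] := cotR.
pose t1 := Triple u; pose t2 := Triple (a \o u : {linear tensor M N -> Z}).
have [||F1 [G1 FG1]] := @tri_ses _ _ _ t t1 (ind M Y) j i q' q jq iq.
- by move=> m y; rewrite -uj /= tensor_map_tens.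
- by move=> m y; rewrite /= qu /= tensor_map_tens.
have [||F2 [G2 FG2]] := @tri_ses _ _ _ t1 t2 (upper_triple M X) a idfun p \0%R
  ap (short_exact_0id _ zero_modP).
- by [].
- by move=> m y; have [_ ex _] := ap; exact: (exact_comp0 ex).
have [K [g [c [d [fg cd]]]]] := short_exact_mono_comp FG1 FG2.
have [f fg'] := short_exact_iso1 fg (iso_sym tA).
exists (tri_mod t2), K, f, g; split=> //; first by exists t2; split=> //; exact: iso_refl.
apply: extB cd _ _; last exact: vee_upper_triple.
by apply: vee_ind torM _ wY => //; rewrite prednK.
Qed.

Lemma frakB_comp_right_cotorsion : coresolving (comp_class M cM cN) ->
  closed_extensions (vee (frakB M cX cY) n.-1) ->
  right_cotorsion_pair n (frakB M cX cY) (comp_class M cM cN) /\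
  hereditary n (frakB M cX cY) (comp_class M cM cN).
Proof.
move=> [_ coker] extB.
have ext i C D : frakB M cX cY C -> comp_class M cM cN D -> Ext_vanishes i.+1 C D.
  move=> CC DD; apply: Ext_vanishes_of_coresolving coker _ _ _ _ DD.
    move=> A; have [D' [K [f [g [[fi _ _] DD' _]]]]] := comp_coapproximation A extB.
    by exists D', f.
  by move=> D'; exact: Ext1_frakB_comp.
split; last by move=> C D; exact: ext.
split; last by move=> A; exact: comp_coapproximation.
- by have [sX _ _] := cotR; have [sY _ _] := cotS; exact: comp_class_summands.
- by move=> [|i] C D // _; exact: ext.
Qed.
End Part2.

(** * The two cotorsion pairs *)

Theorem proposition5p1 (R S : pzRingType) (M : bimodType R S) (n : nat)
    (n_ge1 : (1 <= n)%N)
    (cX cM : mod_class R) (cY cN : mod_class S)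
    (admX : admissible cX) (admM : admissible cM)
    (admY : admissible cY) (admN : admissible cN) :
  (left_cotorsion_pair n cX cM ->
   left_cotorsion_pair n cY cN ->
   (forall j (Z : lmodType R), (1 <= j <= n)%N -> cM Z -> Ext_vanishes j M Z) ->
   resolving (comp_class M cX cY) ->
   closed_extensions (wedge (frakD M cM cN) n.-1) ->
   left_cotorsion_pair n (comp_class M cX cY) (frakD M cM cN) /\
   hereditary n (comp_class M cX cY) (frakD M cM cN))
  /\
  (right_cotorsion_pair n cX cM ->
   right_cotorsion_pair n cY cN ->
   (forall j (Y : lmodType S), (1 <= j <= n)%N -> cY Y -> Tor_vanishes j M Y) ->
   coresolving (comp_class M cM cN) ->
   closed_extensions (vee (frakB M cX cY) n.-1) ->
   right_cotorsion_pair n (frakB M cX cY) (comp_class M cM cN) /\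
   hereditary n (frakB M cX cY) (comp_class M cM cN)).
Proof.
split=> [cotR cotS extM res extD|cotR cotS torM cores extB].
  exact: comp_frakD_left_cotorsion.
exact: frakB_comp_right_cotorsion.
Qed.
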